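(* Let $G$ be a locally compact group with a compact normal subgroup $A$ such that $G/A$ is $\Pi$-procyclic. Then $G$ contains a closed $\Pi$-procyclic subgroup $H_\Pi$ such that $G=AH_\Pi$.
   Context: A topological group $B$ is periodic if it is locally compact, totally disconnected, and $\overline{\langle b\rangle}$ is compact for all $b\in B$. For a periodic locally compact abelian group $B$ and a prime $p$, the $p$-primary component $B_p$ is the set of $b\in B$ such that $\overline{\langle b\rangle}$ is a pro-$p$ group. $B$ is $\Pi$-procyclic if it is a periodic locally compact abelian group each of whose $p$-primary components is either a finite cyclic $p$-group (possibly trivial) or isomorphic to the $p$-adic integers $\mathbb{Z}_p$. *)

(* Defs.v *)
From HB Require Import structures.
From mathcomp Require Import all_boot all_algebra.
From mathcomp Require Import all_classical.
From mathcomp Require Import topology.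

Set Implicit Arguments.
Unset Strict Implicit.
Unset Printing Implicit Defensive.

Local Open Scope classical_set_scope.

Record TopGroup := {
  tg_car :> topologicalType;
  tg_mul : tg_car -> tg_car -> tg_car;
  tg_inv : tg_car -> tg_car;
  tg_one : tg_car;
  tg_mulA : forall x y z, tg_mul x (tg_mul y z) = tg_mul (tg_mul x y) z;
  tg_mul1g : forall x, tg_mul tg_one x = x;
  tg_mulVg : forall x, tg_mul (tg_inv x) x = tg_one;
  tg_mul_cont : continuous (fun z : tg_car * tg_car => tg_mul z.1 z.2);
  tg_inv_cont : continuous tg_inv
}.

Arguments tg_mul {_}.
Arguments tg_inv {_}.
Arguments tg_one {_}.

Section TopGroupDefs.
Variable B : TopGroup.
Implicit Types (S K N : set B) (b x y : B).

Definition locally_compact_group : Prop :=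
  hausdorff_space B /\ locally_compact [set: B].

Definition subgroup S : Prop :=
  S tg_one /\ (forall x y, S x -> S y -> S (tg_mul x y)) /\
  (forall x, S x -> S (tg_inv x)).

Definition normal_subgroup S : Prop :=
  subgroup S /\ forall g x, S x -> S (tg_mul (tg_inv g) (tg_mul x g)).

Definition gpown b (n : nat) : B := iter n (tg_mul b) tg_one.
Definition gpowz b (z : int) : B :=
  match z with
  | Posz n => gpown b n
  | Negz n => tg_inv (gpown b n.+1)
  end.

Definition cyc b : set B := [set x | exists z : int, x = gpowz b z].

Definition closure_in S (X : set B) : set B := closure X `&` S.

Definition open_in K N : Prop := exists2 U : set B, open U & N = U `&` K.

Definition has_index K N (n : nat) : Prop :=
  exists r : 'I_n -> B,
    [/\ forall i, K (r i),
        forall i j, N (tg_mul (tg_inv (r i)) (r j)) -> i = j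
      & forall x, K x -> exists i, N (tg_mul (tg_inv (r i)) x)].

(** K (a subgroup, with the subspace topology) is a pro-p group:
    a profinite group (compact, totally disconnected) each of whose open
    normal subgroups has p-power index. *)
Definition pro_p (p : nat) K : Prop :=
  [/\ compact K, totally_disconnected K &
      forall N, subgroup N -> N `<=` K ->
        (forall g x, K g -> N x -> N (tg_mul (tg_inv g) (tg_mul x g))) ->
        open_in K N -> exists k : nat, has_index K N (p ^ k)].

Definition primary_comp (p : nat) S : set B :=
  [set b | S b /\ pro_p p (closure_in S (cyc b))].

Definition finite_cyclic_pgroup (p : nat) S : Prop :=
  exists b (k : nat), S = cyc b /\ gpown b (p ^ k) = tg_one.
End TopGroupDefs.

(** * The p-adic integers Z_p = lim Z/p^n Z, realised as compatible
      sequences of residues with the product (pointwise) topology of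
      discrete nat's. *)
Definition Zp_carrier : Type := {ptws nat -> nat}.

Definition Zp_set (p : nat) : set Zp_carrier :=
  [set x | forall n, (x n < p ^ n)%N /\ (x n.+1 %% p ^ n = x n)%N].

Definition Zp_add (p : nat) (x y : Zp_carrier) : Zp_carrier :=
  fun n => ((x n + y n) %% p ^ n)%N.

Section TopGroupDefs2.
Variable B : TopGroup.
Implicit Types (S : set B).

Definition iso_Zp (p : nat) S : Prop :=
  exists (f : B -> Zp_carrier) (g : Zp_carrier -> B),
    [/\ (forall x, S x -> Zp_set p (f x)),
        (forall y, Zp_set p y -> S (g y)),
        (forall x, S x -> g (f x) = x) &
        (forall y, Zp_set p y -> f (g y) = y)] /\
    [/\ (forall x y, S x -> S y -> f (tg_mul x y) = Zp_add p (f x) (f y)),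
        {within S, continuous f} &
        {within Zp_set p, continuous g}].

Definition locally_compact_in S : Prop :=
  forall x, S x -> exists K : set B,
    [/\ compact K, K `<=` S &
        exists U : set B, [/\ open U, U x & U `&` S `<=` K]].

Definition pi_procyclic_in S : Prop :=
  [/\ subgroup S,
      (forall x y, S x -> S y -> tg_mul x y = tg_mul y x) &
      locally_compact_in S] /\ [/\
      totally_disconnected S,
      (forall b, S b -> compact (closure_in S (cyc b))) &
      (forall p, prime p ->
         finite_cyclic_pgroup p (primary_comp p S) \/ iso_Zp p (primary_comp p S))].
End TopGroupDefs2.

(** G/A is Pi-procyclic: the quotient topological group G/A is characterised
    (up to topological isomorphism) by a continuous open surjective
    homomorphism with kernel A. *)
Definition quotient_pi_procyclic (G : TopGroup) (A : set G) : Prop :=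
  exists (Q : TopGroup) (pi : G -> Q),
    [/\ forall x y, pi (tg_mul x y) = tg_mul (pi x) (pi y),
        continuous pi &
        (forall U : set G, open U -> open (pi @` U))] /\ [/\
        (forall q : Q, exists x, pi x = q),
        (forall x, pi x = tg_one <-> A x) &
        pi_procyclic_in [set: Q]].

(* Main.v *)
(** Write pi : G -> Q for the quotient map and <x> for closed monothetic subgroups.
    The Pi-procyclic group Q is the union of an increasing sequence of compact open
    procyclic subgroups U_0, U_1, ..., with U_i of index s_i in U_(i+1).  By
    compactness there are g_i in G such that pi g_i generates U_i topologically and
    g_i = g_(i+1)^(s_i).  The closed subgroup <g_i> is compact and covers U_i, but
    it need not be totally disconnected, because A need not be.

    To repair this we replace every g_i by the limit h_i of g_i^a along one and the
    same ultrafilter F of integers a, which preserves the relations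
    h_i = h_(i+1)^(s_i).  For F we take integers that converge to 1 in the profinite
    completion and such that, for every real t, the class of a t modulo 1 converges
    to a torsion element.  The first property gives pi h_i = pi g_i.  For a
    neighbourhood W of 1, the set E of integers n with g_i^n in W is syndetic, so by
    Bogolyubov's theorem E - E + E - E contains a Bohr set, and the second property
    of F yields d > 0 with h_i^n in W W^-1 W W^-1 (up to closure) for all n in dZ.
    Hence <h_i> is profinite, and H is the union of the <h_i>.  Its part over U_i is
    exactly <h_i>, which makes it closed and reduces its p-component to that of a
    single procyclic group <h_i>. *)

Require Import Defs.
From HB Require Import structures.
From mathcomp Require Import all_boot all_algebra.
From mathcomp Require Import all_classical.
From mathcomp Require Import topology.
From mathcomp Require Import all_order reals normedtype trigo.
From mathcomp Require Import ring lra zify.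

Set Implicit Arguments.
Unset Strict Implicit.
Unset Printing Implicit Defensive.

Import Order.TTheory GRing.Theory Num.Theory.
Import numFieldNormedType.Exports.

Local Open Scope classical_set_scope.
Local Open Scope ring_scope.

(** * Bogolyubov's theorem *)

Section Cosine.
Variable R : realType.
Implicit Types t u v w : R.

(** The ultrafilter comes from duality. The characters of a compact monothetic group form a subgroup
    of the discrete group $R/Z$, and the group is profinite exactly when this subgroup is torsion.
    As $Q/Z$ is divisible, the abstract group $R/Z$ retracts onto it. Such a retraction is a point
    of the Bohr compactification of $Z$, that is, a limit of multiplications by integers $a$. Along
    these $a$ the powers $g_i^a$ tend to an element on which all characters are torsion, while
    images in profinite groups do not move, since the retraction is the identity on $Q/Z$. The
    retraction depends on no group, so one choice serves all $i$. No dual group is formed. Torsion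
    values are assigned to one angle at a time, subject to the condition that finitely many
    assignments are always approximable by one integer; Bogolyubov's theorem replaces duality by
    supplying finitely many angles that control the return times of $g_i$ to a neighbourhood of
    1. *)

Definition cosc t : R := cos (2 * pi * t).
Definition sinc t : R := sin (2 * pi * t).

Lemma cosc_int (t : R) (z : int) : cosc (t + z%:~R) = cosc t.
Proof.
have H (n : nat) s : cosc (s + n%:R) = cosc s.
  elim: n s => [|n IH] s; first by rewrite addr0.
  rewrite -natr1 addrA /cosc.
  have -> : 2 * pi * (s + n%:R + 1) = 2 * pi * (s + n%:R) + pi *+ 2 :> R.
    by rewrite mulr2n; ring.
  by rewrite cosD2pi -/(cosc _) IH.
case: z => n; first exact: H.
by rewrite NegzE -{2}(subrK (n.+1)%:R t) H.
Qed.

Lemma cosc0 : cosc 0 = 1. Proof. by rewrite /cosc mulr0 cos0. Qed.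

Lemma coscM u v : cosc u * cosc v = (cosc (u + v) + cosc (u - v)) / 2.
Proof.
by rewrite /cosc (mulrDr _ u v) (mulrBr _ u v) (cosD (_ * u)) (cosB (_ * u)); field.
Qed.

Lemma coscB u v : cosc (u - v) = cosc u * cosc v + sinc u * sinc v.
Proof. by rewrite /cosc mulrBr cosB. Qed.

Lemma cosc_ge0 t (z : int) : `|t - z%:~R| <= 1 / 4 -> 0 <= cosc t.
Proof.
move=> h; have -> : cosc t = cosc (t - z%:~R).
  by rewrite -(cosc_int (t - _) z) subrK.
move: h; rewrite ler_norml => /andP[h1 h2].
apply: cos_ge0_pihalf; have := pi_gt0 R; nra.
Qed.

Lemma cosc_geN1 t : -1 <= cosc t. Proof. exact: cos_geN1. Qed.

(** Orthogonality of the characters of $Z/N$, on real parts. Reducing [x] modulo [N] gives a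
    frequency [y] strictly between 0 and 1, where $\sin(\pi y) \neq 0$; multiplied by this sine the
    sum telescopes. *)
Lemma sum_cosc_eq0 (N : nat) (x : int) : ~~ (N%:Z %| x)%Z ->
  \sum_(k < N) cosc (x%:~R * k%:R / N%:R) = 0.
Proof.
case: (posnP N) => [->|N0] Nx; first by rewrite big_ord0.
have NR : N%:R != 0 :> R by rewrite pnatr_eq0 -lt0n.
pose r := (x %% N%:Z)%Z; pose q := (x %/ N%:Z)%Z.
have xE : x = q * N%:Z + r := divz_eq x N.
have r0 : 0 < r.
  rewrite lt0r modz_ge0 ?andbT; last by lia.
  by move: Nx; rewrite dvdzE /r; apply: contra => /eqP; rewrite -dvdzE => /dvdz_mod0P.
have rN : r < N%:Z by rewrite /r ltz_pmod //; lia.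
pose y : R := r%:~R / N%:R.
have y0 : 0 < y by rewrite divr_gt0 ?ltr0n // ltr0z.
have y1 : y < 1 by rewrite ltr_pdivrMr ?ltr0n // mul1r -[N%:R]/((Posz N)%:~R) ltr_int.
have -> : \sum_(k < N) cosc (x%:~R * k%:R / N%:R) = \sum_(k < N) cosc (y * k%:R).
  apply: eq_bigr => k _; rewrite -(cosc_int (y * _) (q * k%:Z)); congr cosc.
  by rewrite xE rmorphD !rmorphM /= /y -!pmulrn; field.
have s0 : sin (pi * y) != 0.
  rewrite gt_eqF //; apply: sin_gt0_pi; have := pi_gt0 R; nra.
apply: (mulfI s0); rewrite mulr0 mulr_sumr.
have tele (n : nat) : \sum_(k < n) sin (pi * y) * cosc (y * k%:R)
   = (sin (pi * y * (2 * n%:R - 1)) + sin (pi * y)) / 2.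
  elim: n => [|n IH].
    by rewrite big_ord0 mulr0 sub0r mulrN1 sinN addNr mul0r.
  rewrite big_ord_recr /= IH /cosc.
  have -> : pi * y * (2 * n.+1%:R - 1) = 2 * pi * (y * n%:R) + pi * y.
    by rewrite -natr1; ring.
  have -> : pi * y * (2 * n%:R - 1) = 2 * pi * (y * n%:R) - pi * y.
    by ring.
  by rewrite sinB sinD; field.
rewrite tele.
have -> : pi * y * (2 * N%:R - 1) = - (pi * y) + 2 * pi * r%:~R by rewrite /y; field.
have sinp (n : nat) t : sin (t + 2 * pi * n%:R) = sin t.
  elim: n t => [|n IH] t; first by rewrite mulr0 addr0.
  rewrite -[n.+1%:R]natr1 mulrDr mulr1 addrA.
  have -> : 2 * pi = pi *+ 2 :> R by rewrite mulr2n; ring.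
  rewrite sinD2pi.
  have -> : pi *+ 2 = 2 * pi :> R by rewrite mulr2n; ring.
  exact: IH.
have -> : r%:~R = `|r|%N%:R :> R by rewrite pmulrn gez0_abs // ltW.
by rewrite sinp sinN addNr mul0r.
Qed.

Lemma sum_cosc_dvd (N : nat) (x : int) : (N%:Z %| x)%Z ->
  \sum_(k < N) cosc (x%:~R * k%:R / N%:R) = N%:R.
Proof.
case: (posnP N) => [->|N0] Nx; first by rewrite big_ord0.
have NR : N%:R != 0 :> R by rewrite pnatr_eq0 -lt0n.
rewrite -[RHS](_ : \sum_(k < N) 1 = _); last by rewrite sumr_const card_ord.
apply: eq_bigr => k _.
case/dvdzP : Nx => q ->.
have -> : (q * N)%:~R * k%:R / N%:R = 0 + (q * k%:Z)%:~R :> R.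
  by rewrite !rmorphM /= -!pmulrn; field.
by rewrite cosc_int cosc0.
Qed.

Lemma coscM3 u v w : cosc u * cosc v * cosc w =
  (cosc (u + v + w) + cosc (u + v - w) + cosc (u - v + w) + cosc (u - v - w)) / 4.
Proof. by rewrite coscM mulrAC mulrDl !coscM; field. Qed.

(** This is $|\hat 1_E(k)|^2$, expanded into a double sum so that everything stays real. *)
Definition power_spectrum (N : nat) (E : {set 'I_N}) (k : R) : R :=
  \sum_(a in E) \sum_(b in E) cosc ((a%:Z - b%:Z)%:~R * k / N%:R).

Lemma power_spectrum_ge0 N (E : {set 'I_N}) k : 0 <= power_spectrum E k.
Proof.
rewrite /power_spectrum.
suff -> : \sum_(a in E) \sum_(b in E) cosc ((a%:Z - b%:Z)%:~R * k / N%:R) =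
  (\sum_(a in E) cosc (a%:R * k / N%:R)) ^+ 2 + (\sum_(a in E) sinc (a%:R * k / N%:R)) ^+ 2.
  by rewrite addr_ge0 ?sqr_ge0.
rewrite !expr2 !mulr_suml -big_split; apply: eq_bigr => a _ /=.
rewrite !mulr_sumr -big_split; apply: eq_bigr => b _ /=.
by rewrite rmorphB /= !mulrBl coscB.
Qed.

Lemma power_spectrum0 N (E : {set 'I_N}) : power_spectrum E 0 = #|E|%:R ^+ 2.
Proof.
have S1 : \sum_(a in E) (1 : R) = #|E|%:R by rewrite sumr_const.
rewrite expr2 -{1}S1 mulr_suml; apply: eq_bigr => a _; rewrite mul1r -S1.
by apply: eq_bigr => b _; rewrite mulr0 mul0r cosc0.
Qed.

(** Parseval: by orthogonality only the diagonal terms survive. *)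
Lemma sum_power_spectrum N (E : {set 'I_N}) :
  \sum_(k < N) power_spectrum E k%:R = N%:R * #|E|%:R.
Proof.
have S1 : \sum_(a in E) (1 : R) = #|E|%:R by rewrite sumr_const.
rewrite /power_spectrum exchange_big /= -S1 mulr_sumr; apply: eq_bigr => a aE.
rewrite exchange_big /= (bigD1 a) //= subrr sum_cosc_dvd ?dvdz0 // big1 ?addr0 ?mulr1 //.
move=> b /andP[bE ba]; rewrite sum_cosc_eq0 //.
apply/negP => /dvdzP[q]; have := ltn_ord a; have := ltn_ord b.
move: ba; rewrite -val_eqE /= => /eqP ba bN aN e.
have [q0|[q1|q1]] : q = 0 \/ (1 <= q \/ q <= -1) by lia.
- by move: e; rewrite q0; lia.
- have : N%:Z <= q * N%:Z by nia.
  by lia.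
- have : q * N%:Z <= - N%:Z by nia.
  by lia.
Qed.

(* Parseval makes the set of large frequencies small, and the other frequencies
   contribute less than the zero frequency to the 4-fold convolution. *)
Lemma bogolyubov_cyclic N (E : {set 'I_N}) (K : nat) : (0 < #|E|)%N -> (N <= K * #|E|)%N ->
  exists2 L : {set 'I_N}, (#|L| <= 2 * K ^ 2)%N &
    forall x : int, (forall k, k \in L -> 0 <= cosc (x%:~R * k%:R / N%:R)) ->
      exists a b c d, [/\ a \in E, b \in E, c \in E, d \in E &
        (N%:Z %| (a%:Z - b%:Z + c%:Z - d%:Z) - x)%Z].
Proof.
move=> E0 NK.
have N0 : (0 < N)%N.
  by case/card_gt0P: E0 => a _; case: (N) a => // -[].
have NR : 0 < N%:R :> R by rewrite ltr0n.
have ER : 0 < #|E|%:R :> R by rewrite ltr0n.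
have KR : N%:R <= K%:R * #|E|%:R :> R by rewrite -natrM ler_nat.
set e : R := #|E|%:R in ER KR *.
pose F (k : 'I_N) := power_spectrum E k%:R.
(* The threshold is such that, by Parseval, the frequencies below it contribute at most $b N e =
   e^4/2$, half of the zero-frequency term $e^4$. *)
pose b := e ^+ 3 / (2 * N%:R).
have b0 : 0 < b by rewrite divr_gt0 ?exprn_gt0 // mulr_gt0.
have bE : b * N%:R * 2 = e ^+ 3 by rewrite /b; field; rewrite gt_eqF.
pose L : {set 'I_N} := [set k | b <= F k]%SET.
exists L.
  have : #|L|%:R * b <= N%:R * e.
    rewrite -sum_power_spectrum mulr_natl -sumr_const.
    apply: (@le_trans _ _ (\sum_(k in L) F k)).
      by apply: ler_sum => k; rewrite inE.
    rewrite [leRHS](bigID (mem L)) /= lerDl.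
    by apply: sumr_ge0 => k _; exact: power_spectrum_ge0.
  move=> h; have : #|L|%:R * e ^+ 2 <= 2 * N%:R ^+ 2.
    have : #|L|%:R * b * (2 * N%:R) <= N%:R * e * (2 * N%:R).
      by rewrite ler_wpM2r // ltW // mulr_gt0.
    have -> : #|L|%:R * b * (2 * N%:R) = #|L|%:R * e ^+ 2 * e.
      have -> : #|L|%:R * b * (2 * N%:R) = #|L|%:R * (b * N%:R * 2) by ring.
      by rewrite bE; ring.
    have -> : N%:R * e * (2 * N%:R) = 2 * N%:R ^+ 2 * e by ring.
    by rewrite ler_pM2r.
  move=> h2; have h3 : #|L|%:R * e ^+ 2 <= (2 * K ^ 2)%N%:R * e ^+ 2.
    apply: (le_trans h2); rewrite natrM natrX -mulrA -exprMn ler_wpM2l //.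
    by rewrite lerXn2r // nnegrE ?mulr_ge0 // ltW.
  by rewrite -(ler_nat R) -(ler_pM2r (exprn_gt0 2 ER)).
move=> x xL.
apply: contrapT => nex.
have dvdzNr (y : int) : (N%:Z %| - y)%Z = (N%:Z %| y)%Z by rewrite !dvdzE abszN.
(* Fourier inversion: the product formula leaves only the frequencies $(a-b) \pm (c-d) \pm x$, and
   if [N] divided one of them, permuting the letters would represent [x]. *)
have S0 : \sum_(k < N) F k ^+ 2 * cosc (x%:~R * k%:R / N%:R) = 0.
  pose f (y : int) (k : 'I_N) : R := cosc (y%:~R * k%:R / N%:R).
  have -> : \sum_(k < N) F k ^+ 2 * cosc (x%:~R * k%:R / N%:R) =
    \sum_(k < N) \sum_(a in E) \sum_(b in E) \sum_(c in E) \sum_(d in E)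
      f (a%:Z - b%:Z) k * f (c%:Z - d%:Z) k * f x k.
    apply: eq_bigr => k _; rewrite expr2 -mulrA mulr_suml; apply: eq_bigr => a _.
    rewrite mulr_suml; apply: eq_bigr => b' _.
    rewrite mulr_suml mulr_sumr; apply: eq_bigr => c _.
    rewrite mulr_suml mulr_sumr; apply: eq_bigr => d _.
    by rewrite mulrA.
  rewrite exchange_big big1 //= => a aE; rewrite exchange_big big1 //= => b' bE'.
  rewrite exchange_big big1 //= => c cE; rewrite exchange_big big1 //= => d dE.
  have -> : \sum_(k < N) f (a%:Z - b'%:Z) k * f (c%:Z - d%:Z) k * f x k =
   (\sum_(k < N) f ((a%:Z - b'%:Z) + (c%:Z - d%:Z) + x) k
   + \sum_(k < N) f ((a%:Z - b'%:Z) + (c%:Z - d%:Z) - x) k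
   + \sum_(k < N) f ((a%:Z - b'%:Z) - (c%:Z - d%:Z) + x) k
   + \sum_(k < N) f ((a%:Z - b'%:Z) - (c%:Z - d%:Z) - x) k) / 4.
    rewrite -!big_split /= mulr_suml; apply: eq_bigr => k _.
    by rewrite /f coscM3 !(rmorphD, rmorphB, rmorphN) /= !(mulrDl, mulrBl, mulNr).
  have z (y : int) : ~ (N%:Z %| y)%Z -> \sum_(k < N) f y k = 0.
    by move=> /negP; exact: sum_cosc_eq0.
  rewrite !z ?addr0 ?mul0r // => h; apply: nex.
  - exists a, b', d, c; split => //.
    by rewrite (_ : _ - _ - x = a%:Z - b'%:Z - (c%:Z - d%:Z) - x)//; ring.
  - exists b', a, c, d; split => //; rewrite -dvdzNr.
    by rewrite (_ : - _ = a%:Z - b'%:Z - (c%:Z - d%:Z) + x)//; ring.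
  - exists a, b', c, d; split => //.
    by rewrite (_ : _ - _ - x = a%:Z - b'%:Z + (c%:Z - d%:Z) - x)//; ring.
  - exists b', a, d, c; split => //; rewrite -dvdzNr.
    by rewrite (_ : - _ = a%:Z - b'%:Z + (c%:Z - d%:Z) + x)//; ring.
have: 0 < \sum_(k < N) F k ^+ 2 * cosc (x%:~R * k%:R / N%:R); last by rewrite S0 ltxx.
pose k0 := Ordinal N0.
have Fk0 : F k0 = e ^+ 2 by exact: power_spectrum0.
have bk0 : k0 \in L.
  have eN : e <= N%:R by rewrite ler_nat -[X in (_ <= X)%N]card_ord max_card.
  rewrite inE Fk0 /b ler_pdivrMr ?mulr_gt0 // exprS mulrC.
  by rewrite ler_wpM2l ?sqr_ge0 //; have := NR; nra.
rewrite (bigID (mem L)) /=.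
have h1 : e ^+ 4 <= \sum_(k in L) F k ^+ 2 * cosc (x%:~R * k%:R / N%:R).
  rewrite (bigD1 k0) //= mulr0 mul0r cosc0 mulr1 Fk0 -exprM lerDl.
  by apply: sumr_ge0 => k /andP[kL _]; rewrite mulr_ge0 ?sqr_ge0 ?xL.
have h2 : - (b * (N%:R * e)) <= \sum_(k < N | k \notin L) F k ^+ 2 * cosc (x%:~R * k%:R / N%:R).
  apply: (@le_trans _ _ (\sum_(k < N | k \notin L) - (b * F k))).
    rewrite sumrN lerN2 -mulr_sumr ler_wpM2l ?(ltW b0) //.
    rewrite -sum_power_spectrum [leRHS](bigID (mem L)) /= lerDr.
    by apply: sumr_ge0 => k _; exact: power_spectrum_ge0.
  apply: ler_sum => k; rewrite inE -ltNge => kb.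
  have Fk : 0 <= F k := power_spectrum_ge0 E k%:R.
  have := cosc_geN1 (x%:~R * k%:R / N%:R); set c := cosc _ => c1.
  have : F k ^+ 2 <= b * F k by rewrite expr2 ler_wpM2r // ltW.
  have : 0 <= F k ^+ 2 := sqr_ge0 _.
  nra.
have h3 : b * (N%:R * e) * 2 = e ^+ 4.
  by rewrite mulrA -mulrA (mulrC e) mulrA bE [RHS]exprSr.
have h4 : 0 < e ^+ 4 by rewrite exprn_gt0.
lra.
Qed.

End Cosine.

(** Compactness is used in this form because the groups need not be metrizable: along a single
    ultrafilter all sequences in compact sets converge at once, and the limits respect continuous
    operations. *)
Lemma ultra_cvg_compact (I : Type) (T : topologicalType) (F : set_system I)
    (K : set T) (u : I -> T) :
  UltraFilter F -> compact K -> F (u @^-1` K) -> exists2 l, K l & u @ F --> l.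
Proof.
move=> FU cK FK; have [l [Kl lcl]] := cK (u @ F) _ FK.
exists l => // V /= Vl; have [//|FV] := in_ultra_setVsetC (u @^-1` V) FU.
by have [y [yV]] := lcl (~` V) V FV Vl.
Qed.

Lemma free_ultrafilter : exists2 F : set_system nat, UltraFilter F & \oo `<=` F.
Proof. by have [F []] := ultraFilterLemma eventually_filter; exists F. Qed.

Definition syndetic (E : set int) :=
  exists L : nat, forall x : int, exists2 i : nat, (i < L)%N & E (x + i%:Z).

(** * Bohr sets in the differences of a syndetic set of integers *)

Section Kronecker.
Variable R : realType.
Implicit Types (e t x y : R).

(** Distance in the circle $R/Z$, which itself is never formed. *)
Definition near_int e t := exists k : int, `|t - k%:~R| <= e.

Lemma near_intW e1 e2 t : e1 <= e2 -> near_int e1 t -> near_int e2 t.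
Proof. by move=> h [k kP]; exists k; exact: le_trans h. Qed.

Lemma near_intD e1 e2 x y : near_int e1 x -> near_int e2 y -> near_int (e1 + e2) (x + y).
Proof.
move=> [k kx] [l ly]; exists (k + l); rewrite rmorphD opprD addrACA.
by apply: (le_trans (ler_normD _ _)); rewrite lerD.
Qed.

Lemma near_intM (k : int) e x : near_int e x -> near_int (`|k|%:~R * e) (k%:~R * x).
Proof.
move=> [l lx]; exists (k * l); rewrite rmorphM -mulrBr normrM -intr_norm.
by rewrite ler_wpM2l // ler0z.
Qed.

Lemma near_int_int (k : int) : near_int 0 k%:~R.
Proof. by exists k; rewrite subrr normr0. Qed.

Lemma near_intDz e x (k : int) : near_int e x -> near_int e (x + k%:~R).
Proof. by move=> h; rewrite -[e]addr0; apply: near_intD => //; exact: near_int_int. Qed.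

Lemma near_int_norm e x : `|x| <= e -> near_int e x.
Proof. by move=> h; exists 0; rewrite subr0. Qed.

Lemma ultra_near_int (I : Type) (F : set_system I) (u : I -> R) : UltraFilter F ->
  exists v, forall e, 0 < e -> F [set a | near_int e (u a - v)].
Proof.
move=> FU; pose f a := u a - (Num.floor (u a))%:~R.
have [||l _ fl] := @ultra_cvg_compact I R F `[0, 1] f FU.
- exact: segment_compact.
- apply: filterS filterT => a _ /=; rewrite in_itv /= /f subr_ge0 floor_le_tmp /=.
  by rewrite lerBlDl ltW // -[1]/(1%:~R) -intrD lt_succ_floor.
exists l => e e0; have h : F (f @^-1` ball l e) := fl _ (nbhsx_ballx l e e0).
apply: filterS h => a /=; rewrite /ball /= => h; exists (Num.floor (u a)).
apply: ltW; apply: le_lt_trans h; rewrite distrC /f le_eqVlt; apply/orP; left; apply/eqP.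
by congr (`|_|); ring.
Qed.

(** The cyclic theorem is applied to initial segments of [E] placed in $Z/N$ with [N] growing.
    Syndeticity keeps their density bounded below, so the number of frequencies is bounded
    independently of [N], and the frequencies converge along an ultrafilter. *)
Lemma bogolyubov_int (E : set int) : syndetic E ->
  exists s : seq R, forall x : int, (forall th, th \in s -> near_int (1 / 8) (x%:~R * th)) ->
    exists a b c f : int, [/\ E a, E b, E c, E f & x = a - b + c - f].
Proof.
move=> [L HL].
have L0 : (0 < L)%N by have [i] := HL 0; case: (L).
(* The segment has length [M n] inside a cyclic group 8 times as large: once $|x| < M$, the number
   $a-b+c-d-x$ has absolute value below $3M$, so that divisibility by $8M$ forces it to be 0. *)
pose M n := (L * n.+1)%N; pose N n := (8 * M n)%N.
have N0 n : (0 < N n)%N by rewrite !muln_gt0 L0.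
pose En n : {set 'I_(N n)} := [set a : 'I_(N n) | `[< E a%:Z >] && (a < M n)%N]%SET.
have cardE n : (n.+1 <= #|En n|)%N.
  have /choice[f fP] : forall j : 'I_n.+1, exists a : 'I_(N n),
      [/\ E a%:Z, (j * L <= a)%N & (a < j.+1 * L)%N].
    move=> j; have [i iL Ei] := HL (j * L)%N%:Z.
    have jn := ltn_ord j.
    have aN : (j * L + i < N n)%N by rewrite /N /M; nia.
    by exists (Ordinal aN); split => /=; [| lia | nia].
  rewrite -[n.+1]card_ord -cardsT -(card_imset (f := f)).
    apply: subset_leq_card; apply/fintype.subsetP => _ /imsetP[j _ ->].
    rewrite inE; have [Ef _ fj] := fP j; apply/andP; split; first exact/asboolP.
    by have := ltn_ord j; rewrite /M; nia.
  move=> i j fij; apply: val_inj => /=.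
  have [_ i1 i2] := fP i; have [_ j1 j2] := fP j; rewrite fij in i1 i2.
  by nia.
pose K := (8 * L)%N; pose m := (2 * K ^ 2)%N.
have HB n := @bogolyubov_cyclic R (N n) (En n) K (leq_trans (ltn0Sn _) (cardE n)).
have {}HB n : exists2 g : 'I_m -> R, (forall i, 0 <= g i <= 1) &
    forall x : int, (forall i, 0 <= cosc (x%:~R * g i)) ->
      exists a b c d, [/\ a \in En n, b \in En n, c \in En n, d \in En n &
        ((N n)%:Z %| (a%:Z - b%:Z + c%:Z - d%:Z) - x)%Z].
  have [|Lam cL LamP] := HB n.
    by have := cardE n; move: #|_| => c; rewrite /N /M /K; nia.
  (* The list is padded to length [m] by the frequency 0, which imposes no condition on [x]. *)
  pose g (i : 'I_m) : R := (nth (Ordinal (N0 n)) (enum Lam) i)%:R / (N n)%:R.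
  exists g.
    move=> i; rewrite /g divr_ge0 //= ler_pdivrMr ?ltr0n // mul1r ler_nat ltnW //.
  move=> x xg; apply: LamP => k kL.
  have kE : k \in enum Lam by rewrite mem_enum.
  have ki : (index k (enum Lam) < m)%N.
    by rewrite (leq_trans _ cL) // fintype.cardE index_mem.
  by have := xg (Ordinal ki); rewrite /g /= nth_index // mulrA.
have /choice[g gP] : forall n, exists g : 'I_m -> R, (forall i, 0 <= g i <= 1) /\
    forall x : int, (forall i, 0 <= cosc (x%:~R * g i)) ->
      exists a b c d, [/\ a \in En n, b \in En n, c \in En n, d \in En n &
        ((N n)%:Z %| (a%:Z - b%:Z + c%:Z - d%:Z) - x)%Z].
  by move=> n; have [h h1 h2] := HB n; exists h.
have [F FU Foo] := free_ultrafilter.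
have /choice[th thP] : forall i : 'I_m, exists l : R, (fun n => g n i) @ F --> l.
  move=> i; have [||l _ ?] := @ultra_cvg_compact nat R F `[0, 1] (fun n => g n i) FU.
  - exact: segment_compact.
  - by apply: filterS filterT => n _ /=; rewrite in_itv; have [/(_ i)] := gP n.
  - by exists l.
exists [seq th i | i <- enum 'I_m] => x xth.
(* Replacing the limit frequency by the [n]-th one moves the multiple by [x] by at most 1/8;
   together with the assumed 1/8 this stays within the 1/4 needed for a nonnegative cosine. *)
pose e : R := 1 / (8 * (`|x|%:~R + 1)).
have x0 : (0 : R) <= `|x|%:~R by rewrite ler0z.
have e0 : 0 < e by rewrite divr_gt0 // mulr_gt0 // ltr_wpDl.
have Fe : F [set n | forall i, `|th i - g n i| < e].
  apply: filter_forall => i.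
  exact: thP i _ (nbhsx_ballx (th i) e e0).
have Fx : F [set n | (`|x| < n)%N].
  by apply: Foo; exists `|x|.+1 => // n /=.
have [n [ne xn]] := filter_ex (filterI Fe Fx).
have [gn /(_ x)[i|]] := gP n.
  have thi : th i \in [seq th i | i <- enum 'I_m] by rewrite map_f // mem_enum.
  have [z zP] := xth _ thi; apply: (@cosc_ge0 _ _ z).
  have -> : x%:~R * g n i - z%:~R = (x%:~R * th i - z%:~R) - x%:~R * (th i - g n i).
    by ring.
  apply: (le_trans (ler_normB _ _)).
  have -> : 1 / 4 = 1 / 8 + 1 / 8 :> R by field.
  rewrite lerD // normrM -intr_norm.
  have := ne i; rewrite /= /e => /ltW h.
  apply: (le_trans (ler_wpM2l x0 h)).
  rewrite mulrA mulr1 ler_pdivrMr ?mulr_gt0 ?ltr_wpDl //.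
  by lra.
move=> a [b [c [d]]]; rewrite !inE.
move=> [/andP[/asboolP Ea aM] /andP[/asboolP Eb bM] /andP[/asboolP Ec cM] /andP[/asboolP Ed dM]].
move=> /dvdzP[q qP]; exists a%:Z, b%:Z, c%:Z, d%:Z; split=> //.
have nM : (n < M n)%N by rewrite /M -[X in (X < _)%N]mul1n; nia.
have xM : (`|x| < M n)%N by exact: ltn_trans nM.
have [q0|[q1|q1]] : q = 0 \/ (1 <= q \/ q <= -1) by lia.
- by move: qP; rewrite q0; lia.
- have : (8 * M n)%N%:Z <= q * (8 * M n)%N%:Z by nia.
  by rewrite -qP; lia.
- have : q * (8 * M n)%N%:Z <= - (8 * M n)%N%:Z by nia.
  by rewrite -qP; lia.
Qed.

End Kronecker.

(** * Integers converging to torsion *)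

Section Torsion.
Variable R : realType.
Implicit Types (e t x y v z : R) (s : seq (R * R)) (C : set (R * R)).

Definition approx s e (a : int) := forall p, p \in s -> near_int e (a%:~R * p.1 - p.2).

Definition approx0 s e (a : int) := forall p, p \in s -> near_int e (a%:~R * p.1).

Definition torsion_mod1 z := exists2 d : nat, (0 < d)%N & exists k : int, d%:R * z = k%:~R.

(** A pair [(th, z)] in [C] prescribes the limit [z] modulo 1 of the multiples $a\,th$.
    Approximability by integers of each finite part is what allows these limits to be realised along
    one filter. *)
Definition approximable C :=
  (forall p, C p -> torsion_mod1 p.2) /\
  forall s, (forall p, p \in s -> C p) -> forall e, 0 < e -> exists a, approx s e a.

(** The circle has no small subgroups: a nonzero deviation [r] of [w] from an integer would leave
    the window of radius 1/4 under repeated doubling, and a single doubling cannot jump from it to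
    the window around another integer. *)
Lemma near_int_mulz_int e w : e <= 1 / 4 -> (forall k : int, near_int e (k%:~R * w)) ->
  exists k : int, w = k%:~R.
Proof.
move=> e4 kw; have [k0 kP] := kw 1; rewrite mul1r in kP.
set r := w - k0%:~R in kP.
have kr (k : int) : near_int e (k%:~R * r).
  have -> : k%:~R * r = k%:~R * w + (- (k * k0))%:~R.
    by rewrite mulrNz intrM /r mulrBr.
  by apply: near_intDz; exact: kw.
have H (n : nat) : `|(2 ^ n)%:R * r| <= 1 / 4.
  elim: n => [|n IH]; first by rewrite expn0 (mul1r r) (le_trans kP).
  have [m] := kr (2 ^ n.+1)%N%:Z; rewrite -pmulrn => mP.
  have e2 : (2 ^ n.+1)%:R * r = 2 * ((2 ^ n)%:R * r) by rewrite expnS natrM mulrA.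
  have m0 : m = 0.
    move: mP IH; rewrite e2 !ler_norml => /andP[a b] /andP[c d].
    have : m%:~R < 1%:~R :> R by lra.
    have : (-1)%:~R < m%:~R :> R by lra.
    by rewrite !ltr_int; lia.
  by move: mP; rewrite m0 subr0 => h; exact: le_trans h e4.
have r0 : r = 0.
  apply: contrapT => /eqP r0; have rp : 0 < `|r| by rewrite normr_gt0.
  pose n := Num.bound (`|r|^-1).
  have hn : `|r|^-1 < n%:R by rewrite archi_boundP // invr_ge0 ltW.
  have := H n; rewrite normrM normr_nat.
  have : `|r|^-1 < (2 ^ n)%:R.
    by apply: lt_trans hn _; rewrite ltr_nat ltn_expl.
  rewrite -(ltr_pM2r rp) mulVf ?gt_eqF //; lra.
by exists k0; apply/eqP; rewrite -subr_eq0; apply/eqP.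
Qed.

Lemma common_torsion s : (forall p, p \in s -> torsion_mod1 p.2) ->
  exists2 d : nat, (0 < d)%N & forall p, p \in s -> exists k : int, d%:R * p.2 = k%:~R.
Proof.
elim: s => [|p s IH] sT; first by exists 1%N.
have [|d d0 dP] := IH; first by move=> q qs; apply: sT; rewrite inE qs orbT.
have [|c c0 [k kP]] := sT p; first by rewrite inE eqxx.
exists (d * c)%N; first by rewrite muln_gt0 d0.
move=> q; rewrite inE => /orP[/eqP->|/dP[l lP]].
  by exists (d%:Z * k); rewrite natrM -mulrA kP rmorphM.
by exists (c%:Z * l); rewrite natrM mulrAC lP rmorphM /= mulrC.
Qed.

(** Dirichlet's pigeonhole argument: among the multiples of [v] by $0, \dots, J$ two have fractional
    parts at distance at most $1/J \le e$. Their difference, up to an integer, lies in [V] and must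
    vanish, so [v] has a denominator at most [J], and $J!$ serves for all [v]. *)
Lemma discrete_subgroup_denominator (V : set R) e : 0 < e ->
  (forall x y, V x -> V y -> V (x - y)) -> (forall k : int, V k%:~R) ->
  (forall v, V v -> `|v| <= e -> v = 0) ->
  exists2 d : nat, (0 < d)%N & forall v, V v -> exists k : int, d%:R * v = k%:~R.
Proof.
move=> e0 VB VZ Ve.
pose J := (Num.bound e^-1).+1.
have J0 : 0 < J%:R :> R by rewrite ltr0n.
have Je : J%:R^-1 <= e.
  rewrite invf_ple ?posrE // ltW //; apply: lt_trans (archi_boundP _) _.
    by rewrite invr_ge0 ltW.
  by rewrite ltr_nat.
have VM v (n : nat) : V v -> V (n%:R * v).
  move=> Vv; elim: n => [|n IH]; first by rewrite mul0r; exact: (VZ 0).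
  have V0 : V (- v) by rewrite -sub0r; apply: VB => //; exact: (VZ 0).
  by rewrite -natr1 mulrDl mul1r -[v in X in V X]opprK; apply: VB => //; rewrite opprK.
exists J`!; first exact: fact_gt0.
move=> v Vv.
pose fr (n : nat) : R := n%:R * v - (Num.floor (n%:R * v))%:~R.
have fr0 n : 0 <= fr n by rewrite subr_ge0 floor_le_tmp.
have fr1 n : fr n < 1.
  by rewrite ltrBlDl -[1]/(1%:~R) -intrD lt_succ_floor.
pose b n : nat := `|Num.floor (J%:R * fr n)|%N.
have bE n : (b n)%:R <= J%:R * fr n < (b n)%:R + 1.
  have f0 : 0 <= Num.floor (J%:R * fr n) by rewrite floor_ge0 mulr_ge0 // ltW.
  have -> : (b n)%:R = (Num.floor (J%:R * fr n))%:~R :> R.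
    by rewrite pmulrn /b gez0_abs.
  by rewrite floor_le_tmp /= -[1]/(1%:~R) -intrD lt_succ_floor.
have bJ n : (b n < J)%N.
  rewrite -(ltr_nat R); have /andP[h _] := bE n; apply: le_lt_trans h _.
  by rewrite -[ltRHS]mulr1 ltr_pM2l.
have [i [j [ij jJ bij]]] : exists i j : nat, [/\ (i < j)%N, (j <= J)%N & b i = b j].
  apply: contrapT => nex.
  have inj : injective (fun i : 'I_J.+1 => Ordinal (bJ i)).
    move=> i j /(congr1 val) /= bij; apply: val_inj => /=.
    case: (ltngtP i j) => // h; exfalso; apply: nex.
      by exists i, j; split => //; rewrite -ltnS.
    by exists j, i; split => //; rewrite -ltnS.
  by have := leq_card _ inj; rewrite !card_ord ltnn.
have vk : fr j - fr i = (j - i)%N%:R * v - (Num.floor (j%:R * v) - Num.floor (i%:R * v))%:~R.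
  by rewrite natrB 1?ltnW // /fr rmorphB /=; ring.
have small : `|fr j - fr i| <= e.
  apply: le_trans Je; rewrite -[leRHS]mul1r ler_pdivlMr //.
  have -> : `|fr j - fr i| * J%:R = `|J%:R * fr j - J%:R * fr i|.
    by rewrite -mulrBr normrM mulrC normr_nat.
  have := bE i; have := bE j; rewrite bij => /andP[h1 h2] /andP[h3 h4].
  by rewrite ler_norml; apply/andP; split; lra.
have := Ve _ _ small; rewrite vk => /(_ _)/eqP; rewrite subr_eq0 => h.
have ji0 : (0 < j - i)%N by rewrite subn_gt0.
have : (j - i %| J`!)%N by apply: dvdn_fact; rewrite ji0 (leq_trans (leq_subr _ _)).
case/dvdnP => q ->; exists (q%:Z * (Num.floor (j%:R * v) - Num.floor (i%:R * v))).
rewrite natrM -mulrA rmorphM /=; congr (_ * _); apply/eqP; apply: h.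
by apply: VB; [exact: VM | exact: VZ].
Qed.

Lemma near_int_scale (k : int) (e : R) x : near_int (e / (`|k|%:~R + 1)) x -> 0 <= e ->
  near_int e (k%:~R * x).
Proof.
move=> h e0; apply: near_intW (near_intM k h).
have k0 : (0 : R) <= `|k|%:~R by rewrite ler0z.
rewrite mulrA ler_pdivrMr ?ltr_wpDl // mulrC; nra.
Qed.

Lemma near_intN e x : near_int e x -> near_int e (- x).
Proof. by move=> h; rewrite -mulN1r; have := near_intM (-1) h; rewrite mul1r. Qed.

(** [P] is a parameter because the filter is also needed for the counterexamples [B] in
    [approximable_extend]. *)
Definition pairs_filter (P : seq (R * R) -> R -> int -> Prop) C : set_system int :=
  filter_from [set p : seq (R * R) * R | (forall q, q \in p.1 -> C q) /\ 0 < p.2]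
              (fun p => P p.1 p.2).

Lemma approx_filter C : approximable C -> ProperFilter (pairs_filter approx C).
Proof.
move=> [_ CA]; apply: filter_from_proper; last first.
  by move=> [s e] /= [sC e0]; have [a aP] := CA s sC e e0; exists a.
apply: filter_from_filter; first by exists ([::], 1).
move=> [s e] [s' e'] /= [sC e0] [sC' e0']; exists (s ++ s', Num.min e e').
  by split; [move=> q; rewrite mem_cat => /orP[/sC|/sC'] | rewrite lt_min e0].
move=> a /= aP; split=> p ps.
  apply: near_intW (aP p _); last by rewrite mem_cat ps.
  by rewrite ge_min lexx.
apply: near_intW (aP p _); last by rewrite mem_cat ps orbT.
by rewrite ge_min lexx orbT.
Qed.

(** The group [V] of limits of $a\,th$, taken over integers [a] that tend to annihilate the angles
    in [C], measures the freedom left for [z]. If [V] has arbitrarily small nonzero elements, every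
    value can be reached, in particular 0. Otherwise [V] has a common denominator [d], and any limit
    [z] compatible with [C] turns out to be torsion. *)
Lemma approximable_extend C (th : R) : approximable C ->
  exists z, approximable (C `|` [set (th, z)]).
Proof.
move=> CA; have [CT CS] := CA.
pose V := [set v | forall s e, (forall q, q \in s -> C q) -> 0 < e ->
  exists2 a, approx0 s e a & near_int e (a%:~R * th - v)].
have split_s z s : (forall q, q \in s -> (C `|` [set (th, z)]) q) ->
    exists2 s', (forall q, q \in s' -> C q) & forall e a, approx s' e a ->
      near_int e (a%:~R * th - z) -> approx s e a.
  move=> sC; exists [seq q <- s | `[< C q >]].
    by move=> q; rewrite mem_filter => /andP[/asboolP].
  move=> e a s'a az q qs; have [Cq|->//] := sC q qs.
  by apply: s'a; rewrite mem_filter qs andbT; exact/asboolP.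
have [dense|] := pselect (forall e, 0 < e -> exists2 v, V v & 0 < `|v| <= e).
  exists 0; split=> [p [/CT//|->]|s /split_s[s' s'C s'P] e e0].
    by exists 1%N => //; exists 0; rewrite mulr0.
  have [|a1 a1P] := CS s' s'C (e / 2); first by rewrite divr_gt0.
  have [|v Vv /andP[v0 ve]] := dense (e / 4); first by rewrite divr_gt0.
  set y := a1%:~R * th; pose f := Num.floor (y / v).
  have vn0 : v != 0 by rewrite -normr_gt0.
  have fP : `|y - f%:~R * v| <= e / 4.
    apply: le_trans ve; rewrite -{1}(divfK vn0 y) -mulrBl normrM ler_piMl //.
    rewrite ger0_norm ?subr_ge0 ?floor_le_tmp // lerBlDl ltW //.
    by rewrite -[1]/(1%:~R) -intrD lt_succ_floor.
  have f0 : (0 : R) <= `|f|%:~R by rewrite ler0z.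
  have [|a2 a2P a2v] := Vv s' ((e / 4) / (`|f|%:~R + 1)) s'C.
    by rewrite divr_gt0 ?divr_gt0 // ltr_wpDl.
  have e4 : 0 <= e / 4 by rewrite divr_ge0 // ltW.
  exists (a1 - f * a2); apply: s'P.
    move=> p ps.
    have -> : (a1 - f * a2)%:~R * p.1 - p.2 = (a1%:~R * p.1 - p.2) + - (f%:~R * (a2%:~R * p.1)).
      by rewrite rmorphB rmorphM /=; ring.
    have /near_intW : e / 2 + e / 4 <= e by lra.
    apply; apply: near_intD; first exact: a1P.
    by apply: near_intN; apply: near_int_scale => //; exact: a2P.
  have -> : (a1 - f * a2)%:~R * th - 0 = (y - f%:~R * v) + - (f%:~R * (a2%:~R * th - v)).
    by rewrite rmorphB rmorphM /= /y; ring.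
  have /near_intW : e / 4 + e / 4 <= e by lra.
  apply; apply: near_intD; first exact: near_int_norm.
  by apply: near_intN; apply: near_int_scale.
move=> ndense.
have VB x y : V x -> V y -> V (x - y).
  move=> Vx Vy s e sC e0.
  have [|a aP ax] := Vx s (e / 2) sC; first by rewrite divr_gt0.
  have [|b bP by'] := Vy s (e / 2) sC; first by rewrite divr_gt0.
  have -> : e = e / 2 + e / 2 by field.
  exists (a - b).
    move=> p ps; rewrite rmorphB mulrBl.
    by apply: near_intD; [exact: aP | apply: near_intN; exact: bP].
  have -> : (a - b)%:~R * th - (x - y) = (a%:~R * th - x) + - (b%:~R * th - y).
    by rewrite rmorphB /=; ring.
  by apply: near_intD => //; exact: near_intN.
have VZ (k : int) : V k%:~R.
  move=> s e sC e0; exists 0.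
    by move=> p _; rewrite mul0r; apply: near_int_norm; rewrite normr0 ltW.
  rewrite mul0r sub0r; apply: near_intN; apply: near_intW (near_int_int _ k).
  exact: ltW.
have [e0 e00 e0P] : exists2 e, 0 < e & forall v, V v -> `|v| <= e -> v = 0.
  apply: contrapT => nex; apply: ndense => e e0; apply: contrapT => nv; apply: nex.
  exists e => // v Vv ve; apply: contrapT => /eqP v0; apply: nv; exists v => //.
  by rewrite normr_gt0 v0.
have [d d0 dP] := discrete_subgroup_denominator e00 VB VZ e0P.
have dR : 0 < d%:R :> R by rewrite ltr0n.
(* Finitely many angles of [C] already force $d\,a\,th$ to be near an integer: an ultrafilter of
   counterexamples would have a limit [v] in [V], for which $d v$ is an integer. *)
have [s0 [e1 [s0C e10 s0P]]] : exists s e, [/\ (forall q, q \in s -> C q), 0 < e &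
    forall a, approx0 s e a -> near_int (1 / 8) (d%:R * (a%:~R * th))].
  apply: contrapT => nex.
  pose B (p : seq (R * R)) e (a : int) := approx0 p e a /\ ~ near_int (1 / 8) (d%:R * (a%:~R * th)).
  have BF : ProperFilter (pairs_filter B C).
    apply: filter_from_proper; last first.
      move=> [s e] /= [sC e0']; apply: contrapT => nB; apply: nex; exists s, e; split => // a sa.
      by apply: contrapT => na; apply: nB; exists a.
    apply: filter_from_filter; first by exists ([::], 1).
    move=> [s e] [s' e'] /= [sC e0'] [sC' e0'']; exists (s ++ s', Num.min e e').
      by split; [move=> q; rewrite mem_cat => /orP[/sC|/sC'] | rewrite lt_min e0'].
    move=> a [/= aP na]; split; split=> // p ps.
      apply: near_intW (aP p _); last by rewrite mem_cat ps.
      by rewrite ge_min lexx.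
    apply: near_intW (aP p _); last by rewrite mem_cat ps orbT.
    by rewrite ge_min lexx orbT.
  have [F [FU BFF]] := ultraFilterLemma BF.
  have [v vP] := ultra_near_int (fun a : int => a%:~R * th) FU.
  have Vv : V v.
    move=> s e sC e0'.
    have FB : F (B s e) by apply: BFF; exists (s, e).
    by have [a [[aB _] av]] := filter_ex (filterI FB (vP e e0')); exists a.
  have [k kP] := dP v Vv.
  have FB : F (B [::] 1) by apply: BFF; exists ([::], 1).
  have [|a [[_ na] /= av]] := filter_ex (filterI FB (vP ((1 / 8) / (`|d%:Z|%:~R + 1)) _)).
    by rewrite !divr_gt0 // ltr_wpDl // ler0z.
  apply: na; have -> : d%:R * (a%:~R * th) = d%:Z%:~R * (a%:~R * th - v) + k%:~R.
    by rewrite -kP -pmulrn; ring.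
  by apply: near_intDz; apply: (near_int_scale av); lra.
have AF := approx_filter CA.
have [F [FU AFF]] := ultraFilterLemma AF.
have [z zP] := ultra_near_int (fun a : int => a%:~R * th) FU.
have FA s e : (forall q, q \in s -> C q) -> 0 < e -> F (approx s e).
  by move=> sC e0'; apply: AFF; exists (s, e).
exists z; split; last first.
  move=> s /split_s[s' s'C s'P] e e0'.
  have [a [as' az]] := filter_ex (filterI (FA s' e s'C e0') (zP e e0')).
  by exists a; exact: s'P.
move=> p [/CT//|-> /=].
have [|t t0 tP] := @common_torsion s0; first by move=> q /s0C /CT.
have tR : 0 < t%:R :> R by rewrite ltr0n.
exists (d * t)%N; first by rewrite muln_gt0 d0.
apply: (@near_int_mulz_int (1 / 4)) => // k.
pose e2 := Num.min (e1 / (`|k * t%:Z|%:~R + 1)) ((1 / 8) / (`|k * (d * t)%N%:Z|%:~R + 1)).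
have e20 : 0 < e2.
  by rewrite lt_min !divr_gt0 // ltr_wpDl // ler0z.
have [a [as0 /= az]] := filter_ex (filterI (FA s0 e2 s0C e20) (zP e2 e20)).
(* [t] clears the denominators of the values in [s0], so $k t a$ annihilates the angles of [s0] up
   to [e1]. Hence all multiples of $d t z$ are within 1/4 of integers. *)
have h : near_int (1 / 8) (d%:R * ((k * t%:Z * a)%:~R * th)).
  apply: s0P => q qs; have [l lP] := tP q qs.
  have -> : (k * t%:Z * a)%:~R * q.1 = (k * t%:Z)%:~R * (a%:~R * q.1 - q.2) + (k * l)%:~R.
    by rewrite !rmorphM /= -lP -pmulrn; ring.
  apply: near_intDz; apply: near_int_scale; last exact: ltW.
  by apply: near_intW (as0 q qs); rewrite ge_min lexx.
have -> : k%:~R * ((d * t)%:R * z) = d%:R * ((k * t%:Z * a)%:~R * th)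
   + - ((k * (d * t)%N%:Z)%:~R * (a%:~R * th - z)).
  by rewrite !rmorphM /= -!pmulrn ?natrM; ring.
have -> : 1 / 4 = 1 / 8 + 1 / 8 :> R by field.
apply: near_intD => //; apply: near_intN; apply: near_int_scale; last by lra.
by apply: near_intW az; rewrite ge_min lexx orbT.
Qed.

(** Zorn's lemma runs over sets [A] with [A] joined to [C0] approximable, which also admits the
    empty chain, since the integer 1 approximates [C0] exactly. The pairs $(1/d, 1/d)$ of [C0] are
    there to force $a \equiv 1$ modulo [d] later. *)
Lemma approximable_total : exists2 C, approximable C &
  (forall d : nat, (0 < d)%N -> C (d%:R^-1, d%:R^-1)) /\ forall th, exists z, C (th, z).
Proof.
pose C0 : set (R * R) := [set p | exists2 d : nat, (0 < d)%N & p = (d%:R^-1, d%:R^-1)].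
have [A [AA Amax]] : exists A, approximable (A `|` C0) /\
    forall B, A `<` B -> ~ approximable (B `|` C0).
  apply: (@Zorn_bigcup _ (fun A => approximable (A `|` C0))) => F FP Ftot.
  split=> [p [[A FA Ap]|[d d0 ->]]|s sF e e0].
  - by have [+ _] := FP A FA; apply; left.
  - by exists d => //; exists 1; rewrite mulfV // pnatr_eq0 -lt0n.
  have [A [FA sA]] : exists A, (F A \/ A = set0) /\ forall q, q \in s -> (A `|` C0) q.
    elim: s sF => [|p s IH] sF; first by exists set0; split; [right|].
    have [|A [FA sA]] := IH; first by move=> q qs; apply: sF; rewrite inE qs orbT.
    have [[B FB Bp]|C0p] := sF p (mem_head _ _); last first.
      by exists A; split => // q; rewrite inE => /orP[/eqP->|/sA//]; right.
    have [AB|BA] : A `<=` B \/ B `<=` A.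
      by case: FA => [FA|->]; [exact: Ftot | left].
    - exists B; split; first by left.
      move=> q; rewrite inE => /orP[/eqP->|/sA[/AB|]]; by [left|right].
    - exists A; split => // q; rewrite inE => /orP[/eqP->|/sA//].
      by left; exact: BA.
  case: FA => [FA|A0]; first by have [_ h] := FP A FA; exact: h.
  exists 1 => q /sA; rewrite A0 => -[//|[d d0 ->]] /=.
  by rewrite mul1r subrr; apply: near_int_norm; rewrite normr0 ltW.
exists (A `|` C0) => //; split=> [d d0|th]; first by right; exists d.
have [z zP] := approximable_extend th AA.
exists z; apply: contrapT => nC.
apply: (Amax (A `|` [set (th, z)])); last by rewrite setUAC.
split; first by left.
by move=> /(_ (th, z)) h; apply: nC; left; apply: h; right.
Qed.

(* Integers "converging" to a retraction of R/Z onto its torsion subgroup. *)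
Lemma torsion_ultrafilter : exists2 F : set_system int, UltraFilter F &
  (forall d : nat, (0 < d)%N -> F [set a | (d%:Z %| a - 1)%Z]) /\
  forall E, syndetic E -> exists2 d : nat, (0 < d)%N & forall t : int, (d%:Z %| t)%Z ->
    F [set a | exists a1 a2 a3 a4, [/\ E a1, E a2, E a3, E a4 & t * a = a1 - a2 + a3 - a4]].
Proof.
have [C CA [CZ Ctot]] := approximable_total; have [CT _] := CA.
have [F [FU AFF]] := ultraFilterLemma (approx_filter CA).
have FA s e : (forall q, q \in s -> C q) -> 0 < e -> F (approx s e).
  by move=> sC e0'; apply: AFF; exists (s, e).
exists F => //; split=> [d d0|E /(bogolyubov_int R)[s sP]].
  have dR : 0 < d%:R :> R by rewrite ltr0n.
  (* With this precision $a - 1 - kd$ is an integer of absolute value at most 1/2, hence 0. *)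
  have e0 : 0 < (2 * d%:R)^-1 :> R by rewrite invr_gt0 mulr_gt0.
  apply: filterS (FA [:: (d%:R^-1, d%:R^-1)] _ _ e0); last first.
    by move=> q; rewrite inE => /eqP ->; exact: CZ.
  move=> a /(_ _ (mem_head _ _))[k /= kP].
  apply/dvdzP; exists k; apply/eqP; rewrite -subr_eq0; apply/eqP.
  suff : `|(a - 1 - k * d)%:~R| < 1 :> R by rewrite -intr_norm ltrz1; lia.
  have -> : (a - 1 - k * d)%:~R = d%:R * (a%:~R / d%:R - d%:R^-1 - k%:~R) :> R.
    by rewrite !rmorphB rmorphM /= -pmulrn; field; rewrite gt_eqF.
  rewrite normrM normr_nat; apply: (@le_lt_trans _ _ (d%:R * (2 * d%:R)^-1)).
    by rewrite ler_wpM2l // ltW.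
  have -> : d%:R * (2 * d%:R)^-1 = 2^-1 :> R by field; rewrite gt_eqF.
  by lra.
have /choice[c cP] := Ctot.
pose s' := [seq (th, c th) | th <- s].
have s'C q : q \in s' -> C q by move=> /mapP[th _ ->].
(* [d] clears the denominators of the limit values at all Bohr frequencies of [E]; for [t] divisible
   by [d] the limits of $t a\,th$ are therefore integers. *)
have [|d d0 dP] := @common_torsion s'; first by move=> q /s'C /CT.
exists d => // t /dvdzP[k kt].
have e0 : 0 < (1 / 8) / (`|t|%:~R + 1) :> R by rewrite !divr_gt0 // ltr_wpDl // ler0z.
apply: filterS (FA s' _ s'C e0) => a aP; apply: sP => th ths.
have ths' : (th, c th) \in s' by exact: map_f.
have [l lP] := dP _ ths'; have := aP _ ths' => /= h.
have -> : (t * a)%:~R * th = t%:~R * (a%:~R * th - c th) + (k * l)%:~R.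
  by rewrite !rmorphM /= -lP kt rmorphM /= -pmulrn; ring.
by apply: near_intDz; apply: (near_int_scale h); lra.
Qed.

End Torsion.

(** * Topological groups *)

Local Close Scope ring_scope.

Declare Scope tg_scope.
Delimit Scope tg_scope with TG.
Local Notation "x * y" := (tg_mul x y) : tg_scope.
Local Notation "x ^-1" := (tg_inv x) : tg_scope.
Local Notation "1" := tg_one : tg_scope.
Local Notation "x ^ z" := (gpowz x z%R) : tg_scope.
Local Open Scope tg_scope.

Section GroupLaws.
Variable B : TopGroup.
Implicit Types (x y z b : B) (S V : set B) (m n : int).

Lemma tg_mulgV x : x * x^-1 = 1.
Proof.
rewrite -(tg_mul1g (x * x^-1)) -{1}(tg_mulVg (x^-1)) -tg_mulA (tg_mulA (x^-1)).
by rewrite tg_mulVg tg_mul1g tg_mulVg.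
Qed.

Lemma tg_mulg1 x : x * 1 = x.
Proof. by rewrite -(tg_mulVg x) tg_mulA tg_mulgV tg_mul1g. Qed.

Lemma tg_mulKg x y : x^-1 * (x * y) = y.
Proof. by rewrite tg_mulA tg_mulVg tg_mul1g. Qed.

Lemma tg_mulVKg x y : x * (x^-1 * y) = y.
Proof. by rewrite tg_mulA tg_mulgV tg_mul1g. Qed.

Lemma tg_mulgK x y : y * x * x^-1 = y.
Proof. by rewrite -tg_mulA tg_mulgV tg_mulg1. Qed.

Lemma tg_mulgVK x y : y * x^-1 * x = y.
Proof. by rewrite -tg_mulA tg_mulVg tg_mulg1. Qed.

Lemma tg_mulgI x y z : x * y = x * z -> y = z.
Proof. by move=> h; rewrite -(tg_mulKg x y) h tg_mulKg. Qed.

Lemma tg_inv_uniq x y : x * y = 1 -> x^-1 = y.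
Proof. by move=> h; apply: (tg_mulgI (x := x)); rewrite tg_mulgV h. Qed.

Lemma tg_invK x : x^-1^-1 = x.
Proof. by apply: tg_inv_uniq; rewrite tg_mulVg. Qed.

Lemma tg_invM x y : (x * y)^-1 = y^-1 * x^-1.
Proof. by apply: tg_inv_uniq; rewrite tg_mulA tg_mulgK tg_mulgV. Qed.

Lemma tg_inv1 : 1^-1 = 1 :> B.
Proof. by apply: tg_inv_uniq; rewrite tg_mul1g. Qed.

Lemma powz1 x : x ^ 1 = x.
Proof. exact: tg_mulg1. Qed.

Lemma gpown_commr x (k : nat) : x * gpown x k = gpown x k * x.
Proof.
by elim: k => [|k IH]; rewrite ?tg_mul1g ?tg_mulg1 //= {1}IH tg_mulA.
Qed.

Lemma powzS x n : x ^ (n + 1) = x * x ^ n.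
Proof.
case: n => k; first by rewrite -PoszD addn1.
rewrite NegzE; case: k => [|k].
  by rewrite addNr /= tg_mulg1 tg_mulgV.
have -> : (- k.+2%:Z + 1 = Negz k)%R by rewrite NegzE; lia.
rewrite -NegzE /=; have := gpown_commr x k.+1; rewrite /= => ->.
by rewrite [X in _ = x * X]tg_invM tg_mulVKg.
Qed.

Lemma powz_pred x n : x ^ (n - 1) = x^-1 * x ^ n.
Proof. by rewrite -{2}(subrK 1%R n) powzS tg_mulKg. Qed.

Lemma powzD x m n : x ^ (m + n) = x ^ m * x ^ n.
Proof.
elim/int_rec: m => [|m IH|m IH]; first by rewrite add0r tg_mul1g.
  by rewrite -addn1 PoszD addrAC !powzS IH tg_mulA.
by rewrite -addn1 PoszD opprD addrAC !powz_pred IH tg_mulA.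
Qed.

Lemma powzN x n : x ^ (- n) = (x ^ n)^-1.
Proof. by apply/esym/tg_inv_uniq; rewrite -powzD subrr. Qed.

Lemma powzB x m n : x ^ (m - n) = x ^ m * (x ^ n)^-1.
Proof. by rewrite powzD powzN. Qed.

Lemma powzM x m n : x ^ (m * n) = (x ^ m) ^ n.
Proof.
elim/int_rec: n => [|n IH|n IH]; first by rewrite mulr0.
  by rewrite -addn1 PoszD mulrDr mulr1 powzS addrC powzD IH.
by rewrite -addn1 PoszD opprD mulrDr mulrN1 powz_pred addrC powzD powzN IH.
Qed.

Lemma pow1z n : 1 ^ n = 1 :> B.
Proof.
by elim/int_rec: n => [//|n IH|n IH]; rewrite -addn1 PoszD ?opprD ?powzS ?powz_pred IH
  ?tg_inv1 tg_mul1g.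
Qed.

Lemma powz_comm x m n : x ^ m * x ^ n = x ^ n * x ^ m.
Proof. by rewrite -!powzD addrC. Qed.

Lemma powzMl x y n : x * y = y * x -> (x * y) ^ n = x ^ n * y ^ n.
Proof.
move=> xy; have xyn m : x ^ m * y = y * x ^ m.
  elim/int_rec: m => [|m IH|m IH]; first by rewrite tg_mul1g tg_mulg1.
    by rewrite -addn1 PoszD powzS -tg_mulA IH !tg_mulA xy.
  rewrite -addn1 PoszD opprD powz_pred -tg_mulA IH; apply: (@tg_mulgI x).
  by rewrite !tg_mulA tg_mulgV tg_mul1g xy tg_mulgK.
elim/int_rec: n => [|n IH|n IH]; first by rewrite tg_mul1g.
  by rewrite -addn1 PoszD !powzS IH -!tg_mulA; congr (x * _); rewrite !tg_mulA xyn.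
rewrite -addn1 PoszD opprD !powz_pred IH tg_invM.
have c : y * (x^-1 * x ^ (- n%:Z)) = (x^-1 * x ^ (- n%:Z)) * y.
  by rewrite -powz_pred xyn.
apply: (@tg_mulgI y); rewrite [RHS]tg_mulA c.
by rewrite -!tg_mulA !tg_mulVKg.
Qed.

Lemma subgroup1 S : subgroup S -> S 1. Proof. by case. Qed.
Lemma subgroupM S x y : subgroup S -> S x -> S y -> S (x * y).
Proof. by case=> _ [+ _]; apply. Qed.
Lemma subgroupV S x : subgroup S -> S x -> S (x^-1).
Proof. by case=> _ [_]; apply. Qed.
Lemma subgroup_powz S x n : subgroup S -> S x -> S (x ^ n).
Proof.
move=> sS Sx; elim/int_rec: n => [|n IH|n IH]; first exact: subgroup1.
  by rewrite -addn1 PoszD powzS; exact: subgroupM.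
by rewrite -addn1 PoszD opprD powz_pred; apply: subgroupM => //; exact: subgroupV.
Qed.

Lemma subgroup_cyc x : subgroup (cyc x).
Proof.
split; first by exists 0%R.
split=> [_ _ [m ->] [n ->]|_ [m ->]]; first by exists (m + n)%R; rewrite powzD.
by exists (- m)%R; rewrite powzN.
Qed.

Lemma cyc_id x : cyc x x. Proof. by exists 1%R; rewrite powz1. Qed.

Lemma cyc_sub S x : subgroup S -> S x -> cyc x `<=` S.
Proof. by move=> sS Sx _ [n ->]; exact: subgroup_powz. Qed.

Lemma subgroupI S V : subgroup S -> subgroup V -> subgroup (S `&` V).
Proof.
move=> sS sV; split; first by split; exact: subgroup1.
split=> [x y [Sx Vx] [Sy Vy]|x [Sx Vx]]; first by split; exact: subgroupM.
by split; exact: subgroupV.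
Qed.

(* S (x^-1 * y) is the relation "x S = y S". *)
Lemma subgroup_coset_sym S x y : subgroup S -> S (x^-1 * y) -> S (y^-1 * x).
Proof. by move=> sS /(subgroupV sS); rewrite tg_invM tg_invK. Qed.

Lemma subgroup_coset_trans S x y z : subgroup S ->
  S (x^-1 * y) -> S (y^-1 * z) -> S (x^-1 * z).
Proof. by move=> sS h1 /(subgroupM sS h1); rewrite -tg_mulA tg_mulVKg. Qed.

Lemma subgroup_mem_coset S x y : subgroup S -> S x -> S (x^-1 * y) -> S y.
Proof. by move=> sS Sx /(subgroupM sS Sx); rewrite tg_mulVKg. Qed.

End GroupLaws.

Arguments gpowz : simpl never.

Lemma morph_powz (B C : TopGroup) (f : B -> C) :
  {morph f : x y / tg_mul x y >-> tg_mul x y} ->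
  [/\ f 1 = 1, forall x, f x^-1 = (f x)^-1 & forall x n, f (x ^ n) = f x ^ n].
Proof.
move=> fM; have f1 : f 1 = 1.
  by apply: (@tg_mulgI _ (f 1)); rewrite -fM !tg_mulg1.
have fV x : f x^-1 = (f x)^-1 by apply/esym/tg_inv_uniq; rewrite -fM tg_mulgV.
split=> // x n; elim/int_rec: n => [//|n IH|n IH].
  by rewrite -addn1 PoszD !powzS fM IH.
by rewrite -addn1 PoszD opprD !powz_pred fM fV IH.
Qed.

Section Topology.
Variable B : TopGroup.
Implicit Types (x y z b : B) (S V U K : set B) (m n : int).

Lemma cvg_tg_mul (I : Type) (F : set_system I) (u v : I -> B) x y : Filter F ->
  u @ F --> x -> v @ F --> y -> (fun i => u i * v i) @ F --> x * y.
Proof.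
move=> FF ux vy.
apply: (@continuous2_cvg I B B B F _ u v (fun a b => a * b)) => //.
exact: (@tg_mul_cont B (x, y)).
Qed.

Lemma cvg_tg_inv (I : Type) (F : set_system I) (u : I -> B) x : Filter F ->
  u @ F --> x -> (fun i => (u i)^-1) @ F --> x^-1.
Proof. by move=> FF ux; apply: continuous_cvg => //; exact: tg_inv_cont. Qed.

Lemma cvg_powz (I : Type) (F : set_system I) (u : I -> B) x n : Filter F ->
  u @ F --> x -> (fun i => u i ^ n) @ F --> x ^ n.
Proof.
move=> FF ux; elim/int_rec: n => [|n IH|n IH]; first exact: cvg_cst.
  rewrite -addn1 PoszD powzS; under eq_fun do rewrite powzS.
  exact: cvg_tg_mul.
rewrite -addn1 PoszD opprD powz_pred; under eq_fun do rewrite powz_pred.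
by apply: cvg_tg_mul => //; exact: cvg_tg_inv.
Qed.

Lemma continuous_mull x : continuous (fun y => x * y).
Proof. by move=> y; apply: cvg_tg_mul; [exact: cvg_cst | exact: cvg_id]. Qed.

Lemma continuous_mulr x : continuous (fun y => y * x).
Proof. by move=> y; apply: cvg_tg_mul; [exact: cvg_id | exact: cvg_cst]. Qed.

Lemma continuous_powz n : continuous (fun y => y ^ n : B).
Proof. by move=> y; apply: cvg_powz; exact: cvg_id. Qed.

Lemma nbhs_translate x V : nbhs (1 : B) V -> nbhs x [set y | V (x^-1 * y)].
Proof.
by move=> V1; apply: (@continuous_mull (x^-1) x); rewrite tg_mulVg.
Qed.

Lemma nbhs_translate1 x V : nbhs x V -> nbhs (1 : B) [set w | V (x * w)].
Proof. by move=> Vx; apply: (@continuous_mull x 1); rewrite tg_mulg1. Qed.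

Lemma nbhs1_split V : nbhs (1 : B) V ->
  exists W : set B, [/\ open W, W 1, forall x, W x -> W x^-1 & forall x y, W x -> W y -> V (x * y)].
Proof.
move=> V1.
have : nbhs ((1, 1) : B * B) [set z | V (z.1 * z.2)].
  by apply: tg_mul_cont => /=; rewrite tg_mul1g.
case=> -[P Q] /= [P1 Q1] PQ.
have : nbhs (1 : B) (P `&` Q `&` (tg_inv @^-1` (P `&` Q))).
  apply: filterI; first exact: filterI.
  by apply: tg_inv_cont; rewrite tg_inv1; exact: filterI.
rewrite nbhsE => -[W [oW W1] WPQ].
exists (W `&` tg_inv @^-1` W); split.
- by apply: openI => //; apply: open_comp => // ? _; exact: tg_inv_cont.
- by split => //=; rewrite tg_inv1.
- by move=> x [Wx Wx']; split => //=; rewrite tg_invK.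
- move=> x y [/WPQ[[Px _] _] _] [/WPQ[[_ Qy] _] _].
  exact: (PQ (x, y)).
Qed.

Lemma nbhs1_closure V : nbhs (1 : B) V ->
  exists2 W : set B, open_nbhs (1 : B) W & closure W `<=` V.
Proof.
move=> /nbhs1_split[W [oW W1 WV WW]]; exists W; first by split.
move=> x /(_ _ (nbhs_translate x (open_nbhs_nbhs (conj oW W1))))[y [Wy /WV Wxy]].
by have := WW _ _ Wy Wxy; rewrite tg_invM tg_invK tg_mulVKg.
Qed.

Lemma subgroup_closure S : subgroup S -> subgroup (closure S).
Proof.
move=> sS; have S1 := subgroup1 sS; split; first exact: subset_closure.
split=> [x y cx cy V Vxy|x cx V Vx].
  have : nbhs ((x, y) : B * B) [set z | V (z.1 * z.2)] by exact: tg_mul_cont.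
  case=> -[P Q] /= [Px Qy] PQ.
  have [a [Sa Pa]] := cx P Px; have [b [Sb Qb]] := cy Q Qy.
  by exists (a * b); split; [exact: subgroupM | exact: (PQ (a, b))].
have : nbhs x [set z | V z^-1] by exact: tg_inv_cont.
by move=> /cx[a [Sa Va]]; exists a^-1; split => //; exact: subgroupV.
Qed.

Lemma subgroup_ccyc x : subgroup (closure (cyc x)).
Proof. by apply: subgroup_closure; exact: subgroup_cyc. Qed.

Lemma ccyc_id x : closure (cyc x) x.
Proof. by apply: subset_closure; exact: cyc_id. Qed.

Lemma ccyc_powz x n : closure (cyc x) (x ^ n).
Proof. by apply: subset_closure; exists n. Qed.

Lemma ccyc_sub S x : subgroup S -> closed S -> S x -> closure (cyc x) `<=` S.
Proof.
move=> sS cS Sx; rewrite [X in _ `<=` X](closure_id S).1 //.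
by apply: closureS; exact: cyc_sub.
Qed.

Lemma open_subgroup S : subgroup S -> nbhs (1 : B) S -> open S.
Proof.
move=> sS S1; rewrite openE => x Sx; apply: filterS (nbhs_translate x S1).
by move=> y; exact: subgroup_mem_coset.
Qed.

Lemma closed_coset S x : closed S -> closed [set y | S (x^-1 * y)].
Proof.
by move=> cS; exact: ((continuous_closedP _).1 (@continuous_mull (x^-1)) S cS).
Qed.

Lemma open_coset S x : open S -> open [set y | S (x^-1 * y)].
Proof.
by move=> cS; apply: (@open_comp _ _ (fun y => x^-1 * y)) => // y _; exact: continuous_mull.
Qed.

Lemma open_subgroup_closed S : subgroup S -> open S -> closed S.
Proof.
move=> sS oS x /(_ _ (nbhs_translate x (open_nbhs_nbhs (conj oS (subgroup1 sS)))))[y [Sy]].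
by move=> /(subgroup_coset_sym sS); exact: subgroup_mem_coset.
Qed.

Lemma tube_mull K U : compact K -> open U -> K `<=` U ->
  nbhs (1 : B) [set w | forall a, K a -> U (w * a)].
Proof.
move=> /compact_near_coveringP cK oU KU.
apply: (cK _ (nbhs (1 : B)) (fun w a => U (w * a))) => a Ka.
have : nbhs ((1, a) : B * B) [set z | U (z.1 * z.2)].
  by apply: tg_mul_cont; rewrite /= tg_mul1g; apply: open_nbhs_nbhs; split => //; exact: KU.
case=> -[P Q] /= [P1 Qa] PQ; exists (Q, P) => //= -[q p] [/= Qq Pp]; exact: (PQ (p, q)).
Qed.

Lemma tube_mulr K U : compact K -> open U -> K `<=` U ->
  nbhs (1 : B) [set w | forall a, K a -> U (a * w)].
Proof.
move=> /compact_near_coveringP cK oU KU.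
apply: (cK _ (nbhs (1 : B)) (fun w a => U (a * w))) => a Ka.
have : nbhs ((a, 1) : B * B) [set z | U (z.1 * z.2)].
  by apply: tg_mul_cont; rewrite /= tg_mulg1; apply: open_nbhs_nbhs; split => //; exact: KU.
case=> -[P Q] /= [P1 Qa] PQ; exists (P, Q) => //= -[q p] [/= Qq Pp]; exact: (PQ (q, p)).
Qed.

Hypothesis hB : hausdorff_space B.

Lemma closed_set1 x : closed [set x].
Proof. exact: accessible_closed_set1 (hausdorff_accessible hB) x. Qed.

Lemma closure_comm S : (forall x y, S x -> S y -> x * y = y * x) ->
  forall x y, closure S x -> closure S y -> x * y = y * x.
Proof.
move=> SC.
have comm_closed x : closed [set y | x * y = y * x].
  have -> : [set y | x * y = y * x] = [set y | [set (1 : B)] (y^-1 * (x^-1 * (y * x)))].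
    apply/seteqP; split=> y /= h; first by rewrite -h tg_mulKg tg_mulVg.
    apply: (@tg_mulgI _ x^-1); rewrite tg_mulKg; apply: (@tg_mulgI _ y^-1).
    by rewrite h tg_mulVg.
  have cf : continuous (fun y => y^-1 * (x^-1 * (y * x))).
    move=> y; apply: cvg_tg_mul; first by apply: cvg_tg_inv; exact: cvg_id.
    apply: cvg_tg_mul; first exact: cvg_cst.
    by apply: cvg_tg_mul; [exact: cvg_id | exact: cvg_cst].
  exact: ((continuous_closedP _).1 cf _ (@closed_set1 1)).
have S1 x : S x -> closure S `<=` [set y | x * y = y * x].
  by move=> Sx; rewrite (closure_id [set y | x * y = y * x]).1 //; apply: closureS => y; exact: SC.
move=> x y cx cy; suff : closure S `<=` [set x | y * x = x * y] by move=> /(_ x cx) <-.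
rewrite (closure_id [set x | y * x = x * y]).1 //; apply: closureS => z Sz /=.
by rewrite (S1 z Sz y cy).
Qed.

Lemma ccyc_comm x a b : closure (cyc x) a -> closure (cyc x) b -> a * b = b * a.
Proof.
by apply: closure_comm => _ _ [m ->] [n ->]; exact: powz_comm.
Qed.

(** Division with remainder survives the closure because finitely many closed cosets have a closed
    union. *)
Lemma ccyc_split x (s : nat) y : (0 < s)%N -> closure (cyc x) y ->
  exists2 i : nat, (i < s)%N & closure (cyc (x ^ s)) (x ^ (- i%:Z) * y).
Proof.
move=> s0.
pose P (i : nat) := [set y | closure (cyc (x ^ s)) ((x ^ i)^-1 * y)].
pose D := \bigcup_(i < s) P i.
have cD : closed D.
  rewrite /D bigcup_mkord; apply: closed_bigsetU => i _.
  by apply: closed_coset; exact: closed_closure.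
have : cyc x `<=` D.
  move=> _ [n ->].
  have n0 : (0 <= (n %% s)%Z)%R by rewrite modz_ge0 // eqz_nat -lt0n.
  exists `|(n %% s)%Z|%N; first by have := @ltz_pmod n s; rewrite /=; lia.
  rewrite /P /= -powzN -powzD gez0_abs //.
  rewrite {2}(divz_eq n s) addrC -addrA subrr addr0 mulrC powzM.
  exact: ccyc_powz.
move=> /closureS; rewrite -(closure_id D).1 // => h /h.
by move=> [i /= si]; rewrite /P /= => ?; exists i => //; rewrite powzN.
Qed.

(** Two powers of [x] near the same cluster point lie in one coset of [V]. *)
Lemma compact_power K V x : compact K -> (forall n, K (x ^ n)) -> subgroup V ->
  nbhs (1 : B) V -> exists2 k : nat, (0 < k)%N & V (x ^ k).
Proof.
move=> cK Kx sV V1; have [F FU Foo] := free_ultrafilter.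
have [|l _ xl] := @ultra_cvg_compact _ _ F K (fun n : nat => x ^ n) FU cK.
  by apply: filterS filterT => n _; exact: Kx.
have FV : F [set n : nat | V (l^-1 * x ^ n)] := xl _ (nbhs_translate l V1).
have [n /= ln] := filter_ex FV.
have Fn : F [set m | (n < m)%N] by apply: Foo; exists n.+1.
have [m [/= lm nm]] := filter_ex (filterI FV Fn).
exists (m - n)%N; first by rewrite subn_gt0.
have -> : ((m - n)%N%:Z = - n%:Z + m%:Z)%R by lia.
rewrite powzD powzN.
by apply: subgroup_coset_trans lm => //; exact: subgroup_coset_sym.
Qed.

Lemma compact_directed K (D : set (set B)) U : compact K -> D !=set0 ->
  (forall P, D P -> closed P /\ P `<=` K) ->
  (forall P Q, D P -> D Q -> exists2 R, D R & R `<=` P `&` Q) ->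
  open U -> (forall x, (forall P, D P -> P x) -> U x) -> exists2 P, D P & P `<=` U.
Proof.
move=> cK [P0 DP0] DK Ddir oU DU; apply: contrapT => nex.
pose F := filter_from D (fun P => P `\` U).
have FF : ProperFilter F.
  apply: filter_from_proper; last first.
    move=> P DP; apply: contrapT => nP; apply: nex; exists P => // x Px.
    by apply: contrapT => nUx; apply: nP; exists x.
  apply: filter_from_filter; first by exists P0.
  move=> P Q DP DQ; have [R DR RPQ] := Ddir P Q DP DQ; exists R => //.
  by move=> x [/RPQ[]].
have FK : F K by exists P0 => // x [/(proj2 (DK _ DP0))].
have [x [Kx xcl]] := cK F FF FK.
have Px P : D P -> (P `\` U) x.
  move=> DP; have cPU : closed (P `\` U).
    by apply: closedI; [exact: (proj1 (DK _ DP)) | exact: open_closedC].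
  apply: cPU => V Vx; apply: (xcl _ V) => //; exists P => //.
by have [_] := Px P0 DP0; apply; apply: DU => P /Px[].
Qed.

End Topology.

(** * Compact open subgroups *)

Section VanDantzig.
Variable B : TopGroup.
Implicit Types (x y z : B) (S V U K : set B) (m n : int).
Hypothesis hB : hausdorff_space B.

Lemma compact_closed_separated K S : compact K -> closed S -> K `&` S = set0 ->
  exists O O' : set B, [/\ open O, open O', K `<=` O, S `<=` O' & O `&` O' = set0].
Proof.
move=> cK cS KS0.
have [||W [oW W1 WV WW]] := @nbhs1_split _ _ (@tube_mulr B K (~` S) cK _ _).
- exact: closed_openC.
- by move=> x Kx Sx; have : (K `&` S) x by []; rewrite KS0.
have fatten A : open [set x | exists2 a, A a & W (a^-1 * x)] /\
    A `<=` [set x | exists2 a, A a & W (a^-1 * x)].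
  split; last by move=> a Aa; exists a; rewrite // tg_mulVg.
  have -> : [set x | exists2 a, A a & W (a^-1 * x)] =
    \bigcup_(a in A) [set x | W (a^-1 * x)] by [].
  by apply: bigcup_open => a _; exact: open_coset.
have [oK KW] := fatten K; have [oS SW] := fatten S.
exists [set x | exists2 a, K a & W (a^-1 * x)], [set x | exists2 a, S a & W (a^-1 * x)].
split => //; apply/seteqP; split => // x [[a Ka Wa] [c Sc Wc]].
have := WW _ _ Wa (WV _ Wc) a Ka.
by rewrite tg_invM tg_invK tg_mulA tg_mulVKg tg_mulVKg.
Qed.

(** Inside a compact neighbourhood [K] the intersection [Z] of the relatively clopen sets containing
    1 is connected, hence trivial. By compactness one of these sets, [P], is already small, and its
    stabiliser under left translation is an open subgroup contained in [P]. *)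
Lemma van_dantzig V : locally_compact_in [set: B] -> totally_disconnected [set: B] ->
  nbhs (1 : B) V -> exists W : set B, [/\ subgroup W, open W, compact W & W `<=` V].
Proof.
move=> lcB tdB V1; have [K [cK _ [U [oU U1 UK]]]] := lcB 1 I.
rewrite setIT in UK.
have clK : closed K by exact: compact_closed.
pose D : set (set B) :=
  [set P | [/\ P 1, closed P, P `<=` K & exists2 O, open O & P = O `&` K]].
have DK : D K.
  by split => //; [exact: UK | exists setT; [exact: openT | rewrite setTI]].
have DCK P : D P -> closed P /\ P `<=` K by case.
have Ddir P Q : D P -> D Q -> exists2 R, D R & R `<=` P `&` Q.
  move=> [P1 cP PK [O oO PE]] [Q1 cQ QK [O' oO' QE]]; exists (P `&` Q) => //.
  split => //; first exact: closedI; first by move=> x [/PK].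
  by exists (O `&` O'); [exact: openI | rewrite PE QE setIACA setIid].
pose Z := [set x | forall P, D P -> P x].
have clZ : closed Z.
  have -> : Z = \bigcap_(P in D) P by [].
  by apply: closed_bigI => P [].
have Z1 : Z 1 by move=> P [].
have conZ : connected Z.
  apply: contrapT => /connectedPn[E [E0 EZ [sep1 sep2]]].
  have cE b : closed (E b).
    move=> x cx; have Zx : Z x.
      by apply: clZ; apply: closureS cx; rewrite EZ; case: b; [right|left].
    move: Zx; rewrite EZ; case: b cx => cx [Ex|Ex] //; exfalso.
      by have : (E false `&` closure (E true)) x by []; rewrite sep2.
    by have : (closure (E false) `&` E true) x by []; rewrite sep1.
  have [b Eb1] : exists b, E b 1 by move: Z1; rewrite EZ => -[]; [exists false | exists true].
  have EbZ c : E c `<=` Z by rewrite EZ; case: c; [right|left].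
  have ZE x : Z x -> E b x \/ E (~~ b) x by rewrite EZ; case: (b) => /= -[]; tauto.
  have [|||O [O' [oO oO' EO EO' OO']]] := @compact_closed_separated (E b) (E (~~ b)).
  - apply: (subclosed_compact (cE b) cK); apply: subset_trans (EbZ b) _.
    by move=> x /(_ _ DK).
  - exact: cE.
  - move: sep1 sep2; rewrite -!(closure_id _).1 //; case: (b) => //= h _.
    by rewrite setIC.
  have [|x|P [P1 cP PK [Q oQ PE]] PU] := @compact_directed B K D (O `|` O') cK (ex_intro _ K DK) DCK Ddir.
  - exact: openU.
  - by move=> /ZE[/EO|/EO']; [left|right].
  (* Cutting [P] along the separation gives a smaller clopen set around 1 that misses the other half
     of [Z]. *)
  have DP : D (P `&` O).
    split; first by split => //; exact: EO.
    - have -> : P `&` O = P `&` ~` O'.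
        apply/seteqP; split=> x [Px Ox]; split => //.
          by move=> O'x; have : (O `&` O') x by []; rewrite OO'.
        by have [] := PU x Px.
      by apply: closedI => //; exact: open_closedC.
    - by move=> x [/PK].
    - by exists (Q `&` O); [exact: openI | rewrite PE setIAC].
  have [x Ex] := E0 (~~ b).
  have [_ Ox] := EbZ _ x Ex _ DP.
  have : (O `&` O') x by split => //; exact: EO'.
  by rewrite OO'.
have ZE x : Z x -> x = 1.
  move=> Zx; have : connected_component [set: B] 1 x.
    by apply: (connected_component_max Z1 _ conZ).
  by rewrite tdB.
have [|x|P [P1 cP PK [O oO PE]] PU] := @compact_directed B K D (U `&` V°) cK (ex_intro _ K DK) DCK Ddir.
- by apply: openI => //; exact: open_interior.
- by move=> /ZE ->; split.
have oP : open P.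
  have -> : P = O `&` U; last exact: openI.
  apply/seteqP; split=> x; first by move=> Px; split; [move: Px; rewrite PE => -[] | have [] := PU x Px].
  by move=> [Ox /UK Kx]; rewrite PE.
have cptP : compact P := subclosed_compact cP cK PK.
pose W := [set w | forall x, P x <-> P (w * x)].
have sW : subgroup W.
  split; first by move=> x; rewrite tg_mul1g.
  split=> [w w' Ww Ww' x|w Ww x].
    by rewrite -tg_mulA -(Ww _) -(Ww' _).
  by rewrite (Ww (w^-1 * x)) tg_mulVKg.
have WP : W `<=` P by move=> w /(_ 1); rewrite tg_mulg1 => <-.
have oW : open W.
  apply: open_subgroup => //.
  have h := @tube_mull B P P cptP oP (@subset_refl _ P).
  have h' : nbhs (1 : B) [set w | forall a, P a -> P (w^-1 * a)].
    have : nbhs (1 : B)^-1 [set w | forall a, P a -> P (w * a)] by rewrite tg_inv1.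
    exact: tg_inv_cont.
  apply: filterS (filterI h h') => w [w1 w2] x; split; first exact: w1.
  by move=> /w2; rewrite tg_mulKg.
exists W; split => //.
  exact: (subclosed_compact (open_subgroup_closed sW oW) cptP WP).
by move=> x /WP /PU[_ /interior_subset].
Qed.

(** Factorials absorb the individual exponents: near a limit [l] of counterexamples, an exponent [k]
    that works for [l] works as well, and it divides the later factorials. *)
Lemma compact_exponent K V : (forall x y, x * y = y * x) -> compact K -> subgroup K ->
  subgroup V -> nbhs (1 : B) V -> exists2 k : nat, (0 < k)%N & forall x, K x -> V (x ^ k).
Proof.
move=> BC cK sK sV V1; apply: contrapT => nex.
have /choice[x xP] : forall k : nat, exists x, K x /\ ~ V (x ^ (k.+1)`!).
  move=> k; apply: contrapT => nx; apply: nex; exists (k.+1)`!; first exact: fact_gt0.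
  by move=> x Kx; apply: contrapT => nVx; apply: nx; exists x.
have [F FU Foo] := free_ultrafilter.
have [|l Kl xl] := @ultra_cvg_compact _ _ F K x FU cK.
  by apply: filterS filterT => k _ /=; have [] := xP k.
have [|k k0 Vk] := compact_power cK _ sV V1 (x := l).
  by move=> n; exact: subgroup_powz.
have FV : F [set k | V (l^-1 * x k)] := xl _ (nbhs_translate l V1).
have Fk : F [set j | (k <= j)%N] by apply: Foo; exists k.
have [j [/= lj kj]] := filter_ex (filterI FV Fk).
have [_] := xP j; apply.
have /dvdnP[q ->] : (k %| (j.+1)`!)%N by rewrite dvdn_fact // k0 ltnW.
rewrite PoszM mulrC powzM; apply: subgroup_powz => //.
rewrite -(tg_mulVKg l (x j)) powzMl //; apply: subgroupM => //.
exact: subgroup_powz.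
Qed.

End VanDantzig.

(** * Index, profinite type and p-components *)

Section Index.
Variable B : TopGroup.
Implicit Types (x y z : B) (S V U K N : set B).

Lemma cyc_order V x (k : nat) : subgroup V -> (0 < k)%N -> V (x ^ k) ->
  exists2 r : nat, (0 < r)%N & forall n : int, V (x ^ n) <-> (r%:Z %| n)%Z.
Proof.
move=> sV k0 Vk.
have ex : exists k : nat, (0 < k)%N && `[< V (x ^ k) >].
  by exists k; rewrite k0; exact/asboolP.
case: (ex_minnP ex) => r /andP[r0 /asboolP Vr] rmin.
exists r => // n; split => [Vn|/dvdzP[q ->]]; last first.
  by rewrite mulrC powzM; exact: subgroup_powz.
have n0 : (0 <= (n %% r)%Z)%R by rewrite modz_ge0 // eqz_nat -lt0n.
have nr : ((n %% r)%Z < r%:Z)%R by apply: ltz_pmod; lia.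
apply/dvdz_mod0P; apply: contrapT => /eqP nr0.
have /rmin : (0 < `|(n %% r)%Z|)%N && `[< V (x ^ `|(n %% r)%Z|%N) >].
  rewrite lt0n absz_eq0 nr0; apply/asboolP; rewrite gez0_abs //.
  have -> : (n %% r)%Z = (n - r%:Z * (n %/ r)%Z)%R by rewrite {2}(divz_eq n r); ring.
  by rewrite powzB powzM; apply: subgroupM => //; apply: subgroupV => //; exact: subgroup_powz.
by move=> h; lia.
Qed.

Lemma has_index_inj K N m n : subgroup N -> has_index K N m -> has_index K N n -> (m <= n)%N.
Proof.
move=> sN [r [rK rinj _]] [s [_ _ sK]].
have /choice[f fP] : forall i : 'I_m, exists j : 'I_n, N ((s j)^-1 * r i).
  by move=> i; exact: sK.
have finj : injective f.
  move=> i j fij; apply: rinj; apply: (@subgroup_coset_trans _ _ _ (s (f i))) => //.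
    by apply: subgroup_coset_sym.
  by rewrite fij.
by have := leq_card f finj; rewrite !card_ord.
Qed.

Lemma has_index_uniq K N m n : subgroup N -> has_index K N m -> has_index K N n -> m = n.
Proof.
move=> sN h1 h2; apply/eqP; rewrite eqn_leq.
by rewrite (has_index_inj sN h1 h2) (has_index_inj sN h2 h1).
Qed.

Lemma has_index_ccyc N x (r : nat) : subgroup N -> N `<=` closure (cyc x) ->
  open_in (closure (cyc x)) N -> (0 < r)%N ->
  (forall n : int, N (x ^ n) <-> (r%:Z %| n)%Z) -> has_index (closure (cyc x)) N r.
Proof.
move=> sN NK [U oU NE] r0 rP.
exists (fun i => x ^ (i : nat)); split.
- by move=> i; exact: ccyc_powz.
- move=> i j; rewrite -powzN -powzD rP => /dvdzP[q qE]; apply: val_inj => /=.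
  have := ltn_ord i; have := ltn_ord j.
  have [q0|[q1|q1]] : (q = 0 \/ (1 <= q \/ q <= -1))%R by lia.
  + by move: qE; rewrite q0; lia.
  + have : (r%:Z <= q * r%:Z)%R by nia.
    by lia.
  + have : (q * r%:Z <= - r%:Z)%R by nia.
    by lia.
move=> y Ky; have N1 : N 1 := subgroup1 sN.
have U1 : nbhs (1 : B) U.
  by apply: open_nbhs_nbhs; split => //; move: N1; rewrite NE => -[].
have [_ [[n ->] Uy]] := Ky _ (nbhs_translate y U1).
have Ny : N (y^-1 * x ^ n).
  rewrite NE; split => //; have sK := @subgroup_ccyc B x.
  by apply: (subgroupM sK); [exact: (subgroupV sK) | exact: ccyc_powz].
have n0 : (0 <= (n %% r)%Z)%R by rewrite modz_ge0 // eqz_nat -lt0n.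
have nr : ((n %% r)%Z < r%:Z)%R by apply: ltz_pmod; lia.
have ir : (`|(n %% r)%Z| < r)%N by lia.
exists (Ordinal ir) => /=; rewrite gez0_abs //.
apply: (@subgroup_coset_trans _ _ _ (x ^ n)) => //; last exact: subgroup_coset_sym.
rewrite -powzN -powzD rP; apply/dvdzP; exists (n %/ r)%Z.
by have := divz_eq n r; lia.
Qed.

(** Continuity of $n \mapsto x^n$ for the profinite topology on the integers; [p_type] is the same
    for the p-adic topology. Both avoid speaking of quotients of the closed subgroup. *)
Definition profinite_type x := forall V, nbhs (1 : B) V ->
  exists2 d : nat, (0 < d)%N & forall t : int, V (x ^ (d%:Z * t)).

Definition p_type (p : nat) x := forall V, nbhs (1 : B) V ->
  exists j : nat, forall t : int, V (x ^ ((p ^ j)%N%:Z * t)).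

Lemma pro_p_ccyc p x : prime p -> compact (closure (cyc x)) ->
  totally_disconnected (closure (cyc x)) -> p_type p x -> pro_p p (closure (cyc x)).
Proof.
move=> pp cK tK px; split => // N sN NK _ oN; have [U oU NE] := oN.
have [j /(_ 1%R)] : exists j : nat, forall t : int, U (x ^ ((p ^ j)%N%:Z * t)).
  by apply: px; apply: open_nbhs_nbhs; split => //; have := subgroup1 sN; rewrite NE => -[].
rewrite mulr1 => Uj.
have Nj : N (x ^ (p ^ j)%N) by rewrite NE; split => //; exact: ccyc_powz.
have pj0 : (0 < p ^ j)%N by rewrite expn_gt0 prime_gt0.
have [r r0 rP] := cyc_order sN pj0 Nj.
have := (rP _).1 Nj; rewrite /dvdz /= => /(dvdn_pfactor _ _ pp)[k _ rE].
by exists k; rewrite -rE; exact: has_index_ccyc.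
Qed.

(** By compactness [x] has a finite order modulo [N]. As the powers of [x] are dense, this order is
    the index of [N], a power of [p]. *)
Lemma pro_p_power p x N : hausdorff_space B -> pro_p p (closure (cyc x)) ->
  subgroup N -> N `<=` closure (cyc x) -> open_in (closure (cyc x)) N ->
  exists k : nat, N (x ^ (p ^ k)%N).
Proof.
move=> hB [cK _ pK] sN NK oN.
have sK := @subgroup_ccyc B x.
have [|k kP] := pK N sN NK _ oN.
  move=> g y Kg Ny; have Ky := NK _ Ny.
  by rewrite (ccyc_comm hB Ky Kg) tg_mulKg.
have [U oU NE] := oN.
have U1 : nbhs (1 : B) U.
  by apply: open_nbhs_nbhs; split => //; have := subgroup1 sN; rewrite NE => -[].
have [F FU Foo] := free_ultrafilter.
have [|l Kl xl] := @ultra_cvg_compact _ _ F _ (fun n : nat => x ^ n) FU cK.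
  by apply: filterS filterT => n _; exact: ccyc_powz.
have FV : F [set n : nat | U (l^-1 * x ^ n)] := xl _ (nbhs_translate l U1).
have lN (n : nat) : U (l^-1 * x ^ n) -> N (l^-1 * x ^ n).
  rewrite NE => h; split => //; apply: (subgroupM sK); last exact: ccyc_powz.
  exact: (subgroupV sK).
have [n /= /lN ln] := filter_ex FV.
have Fn : F [set m | (n < m)%N] by apply: Foo; exists n.+1.
have [m [/= /lN lm nm]] := filter_ex (filterI FV Fn).
have mn0 : (0 < m - n)%N by rewrite subn_gt0.
have Nmn : N (x ^ (m - n)%N).
  have -> : ((m - n)%N%:Z = - n%:Z + m%:Z)%R by lia.
  rewrite powzD powzN.
  by apply: subgroup_coset_trans lm => //; exact: subgroup_coset_sym.
have [r r0 rP] := cyc_order sN mn0 Nmn.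
have rk : r = (p ^ k)%N by apply: (has_index_uniq sN _ kP); exact: has_index_ccyc.
by exists k; rewrite rP -rk.
Qed.

Lemma closure_in_cyc S x : subgroup S -> closed S -> S x ->
  closure_in S (cyc x) = closure (cyc x).
Proof.
by move=> sS cS Sx; rewrite /closure_in setIidl //; exact: ccyc_sub.
Qed.

Lemma p_type_powz p x (n : int) : p_type p x -> p_type p (x ^ n).
Proof.
move=> px V /px[j jP]; exists j => t.
by rewrite -powzM (_ : (n * _ = (p ^ j)%N%:Z * (n * t))%R) //; ring.
Qed.

Lemma p_type_ccyc p x y : p_type p x -> closure (cyc x) y -> p_type p y.
Proof.
move=> px cy V /nbhs1_closure[W [oW W1] WV].
have [j jP] := px W (open_nbhs_nbhs (conj oW W1)).
exists j => t; apply: WV.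
suff : cyc x `<=` [set z | closure W (z ^ ((p ^ j)%N%:Z * t))].
  move=> /closureS h; have := h y cy; rewrite -(closure_id _).1 //.
  apply: ((continuous_closedP _).1 (@continuous_powz B ((p ^ j)%N%:Z * t)) _).
  exact: closed_closure.
move=> _ [n ->] /=; apply: subset_closure; rewrite -powzM.
by rewrite (_ : (n * _ = (p ^ j)%N%:Z * (n * t))%R) //; ring.
Qed.

(* [y] is the component of [x] at [p]: the limit of [x ^ a] along integers [a]
   tending to the idempotent of the profinite integers supported at [p]. *)
Lemma p_component p x K : prime p -> compact K -> closed K -> subgroup K -> K x ->
  exists2 y, closure (cyc x) y & forall S (j m : nat), closed S -> (0 < m)%N -> coprime p m ->
    (forall a : int, ((p ^ j)%N%:Z %| (a - 1)%R)%Z -> (m%:Z %| a)%Z -> S (x ^ a)) -> S y.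
Proof.
move=> pp cK clK sK Kx.
have [F FU Foo] := free_ultrafilter.
(* By the Chinese remainder theorem [a k] is 1 modulo $p^k$ and 0 modulo the prime-to-p part of
   $k!$, which every positive [m] prime to [p] divides as soon as $k \ge m$. *)
pose a (k : nat) : nat := chinese (p ^ k) (k`!)`_(p^')%N 1 0.
have [|y Ky ya] := @ultra_cvg_compact _ _ F K (fun k => x ^ a k) FU cK.
  by apply: filterS filterT => n _; exact: subgroup_powz.
exists y.
  apply: (closed_cvg _ (@closed_closure _ (cyc x)) _ _ ya).
  by apply: nearW => k; exact: ccyc_powz.
move=> S j m cS m0 pm SP; apply: (closed_cvg _ cS _ _ ya).
have : F [set k | (maxn j m <= k)%N] by apply: Foo; exists (maxn j m).
apply: filterS => k /=; rewrite geq_max => /andP[jk mk]; apply: SP.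
  have co : coprime (p ^ k) (k`!)`_(p^')%N.
    by apply: coprimeXl; rewrite prime_coprime // -p'natE // part_pnat.
  have h := chinese_modl co 1 0.
  have pjk : (p ^ j %| p ^ k)%N by rewrite dvdn_exp2l.
  have h' : (a k = 1 %[mod p ^ j])%N by rewrite -(modn_dvdm (a k) pjk) h (modn_dvdm 1 pjk).
  by rewrite -eqz_mod_dvd !modz_nat h'.
have co : coprime (p ^ k) (k`!)`_(p^')%N.
  by apply: coprimeXl; rewrite prime_coprime // -p'natE // part_pnat.
have h : (chinese (p ^ k) (k`!)`_(p^')%N 1 0 = 0 %[mod (k`!)`_(p^')%N])%N := chinese_modr co 1 0.
rewrite /dvdz /=; apply: (@dvdn_trans (k`!)`_(p^')%N).
  rewrite -(@part_pnat_id (p^')%N m); last by rewrite p'natE // -prime_coprime.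
  by apply: partn_dvd; rewrite ?fact_gt0 // dvdn_fact // m0.
by rewrite /dvdn /a h mod0n.
Qed.

(** Write $d = p^e m$ with [m] prime to [p]. The exponents approximating [y] are divisible by [m],
    so multiplying them by $p^e$ gives multiples of [d]. *)
Lemma p_component_type p x y : prime p -> profinite_type x ->
  (forall S (j m : nat), closed S -> (0 < m)%N -> coprime p m ->
    (forall a : int, ((p ^ j)%N%:Z %| (a - 1)%R)%Z -> (m%:Z %| a)%Z -> S (x ^ a)) -> S y) ->
  p_type p y.
Proof.
move=> pp px yP V /nbhs1_closure[W [oW W1] WV].
have [d d0 dP] := px W (open_nbhs_nbhs (conj oW W1)).
have dE : (d = p ^ logn p d * d`_(p^')%N)%N by rewrite -p_part partnC.
exists (logn p d) => t; apply: WV.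
apply: (yP [set z | closure W (z ^ ((p ^ logn p d)%N%:Z * t))] 0%N (d`_(p^')%N)).
- apply: ((continuous_closedP _).1 (@continuous_powz B ((p ^ logn p d)%N%:Z * t)) _).
  exact: closed_closure.
- exact: part_gt0.
- by rewrite prime_coprime // -p'natE // part_pnat.
move=> a _ /dvdzP[q ->] /=; apply: subset_closure; rewrite -powzM.
rewrite (_ : (_ * (_ * t) = d%:Z * (q * t))%R) //.
by rewrite {3}dE PoszM; ring.
Qed.

End Index.

(** * Pi-procyclic groups *)

Lemma Zp_cvg (z : nat -> Zp_carrier) (w : Zp_carrier) :
  (forall n k : nat, (k <= n)%N -> z n k = w k) -> z @ \oo --> w.
Proof.
move=> zP; apply/(@pointwise_cvgP nat nat) => k.
apply: cvg_near_cst; exists k => // n /= kn; exact: zP.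
Qed.

Section PiProcyclic.
Variable Q : TopGroup.
Implicit Types (x y z b : Q) (S V U K N : set Q).
Hypothesis hQ : hausdorff_space Q.
Hypothesis piQ : pi_procyclic_in [set: Q].

Let QC x y : x * y = y * x.
Proof. by have [[_ + _] _] := piQ; apply. Qed.

Let cK x : compact (closure (cyc x)).
Proof. by have [_ [_ /(_ x I) + _]] := piQ; rewrite /closure_in setIT. Qed.

Let tdK S : totally_disconnected S.
Proof.
have [_ [tQ _ _]] := piQ => x Sx; apply/seteqP; split=> [y|_ ->]; last exact: connected_component_refl.
move=> [C [Cx CS conC] Cy].
have : connected_component [set: Q] x y.
  by exists C => //; split.
by rewrite tQ.
Qed.

Lemma pi_procyclic_basis V : nbhs (1 : Q) V ->
  exists W, [/\ subgroup W, open W, compact W & W `<=` V].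
Proof. by have [[_ _ lQ] [tQ _ _]] := piQ; exact: van_dantzig. Qed.

Lemma pi_procyclic_profinite x : profinite_type x.
Proof.
move=> V /pi_procyclic_basis[W [sW oW cW WV]].
have [|k k0 Wk] := compact_power (@cK x) (@ccyc_powz _ x) sW.
  by apply: open_nbhs_nbhs; split => //; exact: subgroup1.
by exists k => // t; apply: WV; rewrite powzM; exact: subgroup_powz.
Qed.

(** This trades the condition on indices of open subgroups for one on powers, which is easily
    checked for products and inverses. *)
Lemma primary_comp_setT p x : prime p -> primary_comp p [set: Q] x <-> p_type p x.
Proof.
move=> pp; rewrite /primary_comp /= /closure_in setIT; split=> [[_ px]|px]; last first.
  by split => //; apply: pro_p_ccyc => //; exact: tdK.
move=> V /pi_procyclic_basis[W [sW oW _ WV]].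
have [||k [Wk _]] := pro_p_power hQ px (subgroupI sW (@subgroup_ccyc _ x)) _ _.
- by move=> y [].
- by exists W.
by exists k => t; apply: WV; rewrite powzM; exact: subgroup_powz.
Qed.

Lemma subgroup_primary_comp p : prime p -> subgroup (primary_comp p [set: Q]).
Proof.
move=> pp; split; first by apply/primary_comp_setT => // V V1; exists 0%N => t; rewrite pow1z; exact: nbhs_singleton.
split=> [x y /primary_comp_setT-/(_ pp) px /primary_comp_setT-/(_ pp) py|x /primary_comp_setT-/(_ pp) px];
  apply/primary_comp_setT => // V /pi_procyclic_basis[W [sW oW _ WV]].
  have W1 : nbhs (1 : Q) W by apply: open_nbhs_nbhs; split => //; exact: subgroup1.
  have [j jP] := px W W1; have [k kP] := py W W1.
  exists (j + k)%N => t; apply: WV; rewrite powzMl //; apply: subgroupM => //.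
    by rewrite expnD PoszM -mulrA.
  by rewrite expnD PoszM -mulrA mulrCA.
have W1 : nbhs (1 : Q) W by apply: open_nbhs_nbhs; split => //; exact: subgroup1.
have [j jP] := px W W1; exists j => t; apply: WV.
by rewrite -(powz1 x) -powzN -powzM mulN1r powzN; exact: subgroupV.
Qed.

(** Treats finite cyclic groups and copies of $Z_p$ alike: [b] generates the component modulo every
    open subgroup. For $Z_p$ it is the image of 1, and integers approximate p-adic ones by
    truncation. *)
Lemma primary_comp_gen p : prime p -> exists2 b, primary_comp p [set: Q] b &
  forall V, subgroup V -> nbhs (1 : Q) V ->
    (forall z, primary_comp p [set: Q] z -> exists n : int, V ((b ^ n)^-1 * z)).
Proof.
move=> pp; have [_ [_ _ /(_ p pp)]] := piQ.
have sS := subgroup_primary_comp pp; set S := primary_comp p _ in sS *.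
case=> [[b [k [SE _]]]|[f [g [[fS gS fK gK] [fM cf cg]]]]].
  exists b; first by rewrite SE; exact: cyc_id.
  move=> V sV _ z; rewrite SE => -[n ->]; exists n.
  by rewrite tg_mulVg; exact: subgroup1.
have p1 : (1 < p)%N by exact: prime_gt1.
pose e (k : nat) : Zp_carrier := fun n => (k %% p ^ n)%N.
have eZ k : Zp_set p (e k).
  by move=> n; rewrite ltn_mod expn_gt0 (ltnW p1) /e modn_dvdm // dvdn_exp2l.
have gD k : g (e k) * g (e 1%N) = g (e k.+1).
  have Sk : S (g (e k) * g (e 1%N)) by apply: subgroupM => //; exact: gS.
  rewrite -(fK _ Sk) fM ?gK //; try exact: gS.
  by congr g; apply/funext => n; rewrite /Defs.Zp_add /e /= modnDm addn1.
have g0 : g (e 0%N) = 1.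
  by apply: (@tg_mulgI _ (g (e 1%N))); rewrite tg_mulg1 QC gD.
have gk (k : nat) : g (e k) = g (e 1%N) ^ k.
  elim: k => [//|k IH]; rewrite -gD IH -(addn1 k) PoszD addrC powzD powz1 QC //.
exists (g (e 1%N)); first exact: gS.
move=> V sV V1 z Sz.
have [n nP] : exists n, forall w, Zp_set p w -> w n = 0%N -> V (g w).
  apply: contrapT => nex.
  have /choice[w wP] : forall n, exists w, [/\ Zp_set p w, w n = 0%N & ~ V (g w)].
    move=> n; apply: contrapT => nw; apply: nex; exists n => w Zw w0.
    by apply: contrapT => nV; apply: nw; exists w.
  have Ze (n k : nat) : (k <= n)%N -> w n k = e 0%N k.
    have [Zw w0 _] := wP n; move=> kn; rewrite /e mod0n.
    elim: (n - k)%N {-2}k (subnKC kn) => [|d IH] m; first by rewrite addn0 => ->.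
    rewrite addnS -addSn => /IH mE.
    by have [_ <-] := Zw m; rewrite mE mod0n.
  have /subspace_continuousP/(_ _ (eZ 0%N)) c0 := cg.
  have h : nbhs (e 0%N) [set w | Zp_set p w -> V (g w)].
    have Vg : nbhs (g (e 0%N)) V by rewrite g0.
    exact: (c0 V Vg).
  have [n _ nV] := Zp_cvg Ze h.
  by have [Zw _] := wP n; apply; exact: (nV n (leqnn n)).
(* The residue of [z] modulo $p^n$: after division by $b^k$ the residue is 0, and such elements lie
   in [V] by the choice of [n]. *)
pose k : nat := f z n; exists k; rewrite -gk.
set y := (g (e k))^-1 * z.
have Sy : S y by apply: subgroupM => //; apply: subgroupV => //; exact: gS.
rewrite -(fK _ Sy); apply: nP; first exact: fS.
have zE : k = ((e k n + f y n) %% p ^ n)%N.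
  rewrite /k -{1}(tg_mulVKg (g (e k)) z) fM //; last exact: gS.
  by rewrite gK.
have kp : (k < p ^ n)%N := (fS _ Sz n).1; have [yp _] := fS _ Sy n.
have kE : e k n = k by rewrite /e modn_small.
move: zE; rewrite kE => /eqP.
by rewrite -{1}(modn_small kp) -{1}(addn0 k) eqn_modDl mod0n modn_small // => /eqP.
Qed.

(** If a prime [p] divides the order [r] of [x] modulo [S], the p-component of [x] is a limit of
    powers $x^a$ with $a \equiv 1$ modulo [p]. None of them is in [S], as [r] does not divide [a];
    since [S] is open, neither is the limit. *)
Lemma dense_component_sub S x (k : nat) : subgroup S -> nbhs (1 : Q) S -> (0 < k)%N -> S (x ^ k) ->
  (forall p y, prime p -> (p %| k)%N -> primary_comp p [set: Q] y -> closure (cyc x) y -> S y) ->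
  S x.
Proof.
move=> sS S1 k0 Sk Sp; have [r r0 rP] := cyc_order sS k0 Sk.
have rk : (r %| k)%N by have := (rP k).1 Sk.
have [r1|r1] := eqVneq r 1%N; first by rewrite -(powz1 x) rP r1.
have p_r : (pdiv r %| r)%N := pdiv_dvd r.
have pp : prime (pdiv r) by apply: pdiv_prime; lia.
have [y xy yP] := p_component pp (@cK x) (@closed_closure _ _) (@subgroup_ccyc _ x) (@ccyc_id _ x).
have py : primary_comp (pdiv r) [set: Q] y.
  by apply/primary_comp_setT => //; exact: (p_component_type pp (pi_procyclic_profinite x) yP).
have Sy : S y by apply: (Sp _ _ pp _ py xy); exact: dvdn_trans rk.
exfalso; have oS := open_subgroup sS S1.
suff : (~` S) y by [].
apply: (yP (~` S) 1%N 1%N) => //; first exact: open_closedC.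
  by rewrite coprimen1.
move=> a a1 _ /=; rewrite rP => ra.
have : ((pdiv r)%:Z %| a)%Z by apply: dvdz_trans ra; rewrite /dvdz.
move=> pa; have : ((pdiv r)%:Z %| (a - (a - 1)%R)%R)%Z.
  by apply: rpredB => //; rewrite -(expn1 (pdiv r)).
have -> : (a - (a - 1) = 1%N%:Z)%R by lia.
by rewrite dvdzE /= dvdn1 => /eqP h; move: pp; rewrite h.
Qed.

End PiProcyclic.

(** * Compact open procyclic subgroups and their generators *)

Section Chain.
Variable Q : TopGroup.
Implicit Types (x y z b : Q) (S V U K N : set Q).

(** Topological generation, tested modulo each open subgroup. In this form the generators of a
    closed [U] form a closed set and so survive limits. *)
Definition generates U x := U x /\ forall V, subgroup V -> nbhs (1 : Q) V ->
  forall y, U y -> exists n : int, V ((x ^ n)^-1 * y).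

Hypothesis QC : forall x y, x * y = y * x.

Lemma coset_mul V x x' y y' : subgroup V -> V (x^-1 * x') -> V (y^-1 * y') ->
  V ((x * y)^-1 * (x' * y')).
Proof.
move=> sV Vx Vy; have -> : (x * y)^-1 * (x' * y') = (x^-1 * x') * (y^-1 * y').
  by rewrite tg_invM (QC y^-1) -!tg_mulA; congr (_ * _); rewrite !tg_mulA (QC y^-1).
exact: subgroupM.
Qed.

Lemma coset_powz V x y (n : int) : subgroup V -> V (x^-1 * y) -> V ((x ^ n)^-1 * y ^ n).
Proof.
move=> sV Vx; have -> : (x ^ n)^-1 * y ^ n = (x^-1 * y) ^ n.
  have e : x^-1 = x ^ (-1) by rewrite powzN powz1.
  by rewrite (powzMl _ (QC _ _)) e -powzM mulN1r powzN.
exact: subgroup_powz.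
Qed.

Lemma closed_generates U : closed U -> closed (generates U).
Proof.
move=> cU x xcl; split.
  by apply: cU; apply: closureS xcl => y [].
move=> V sV V1 y Uy.
have [z [[Uz zgen] /= Vz]] := xcl _ (nbhs_translate x V1).
have [n nP] := zgen V sV V1 y Uy; exists n.
by apply: (subgroup_coset_trans sV _ nP); exact: coset_powz.
Qed.

Definition cyc_join x V := [set y | exists n : int, V ((x ^ n)^-1 * y)].

Lemma subgroup_cyc_join x V : subgroup V -> subgroup (cyc_join x V).
Proof.
move=> sV; split; first by exists 0%R; rewrite tg_mulVg; exact: subgroup1.
split=> [y z [m my] [n nz]|y [m my]].
  by exists (m + n)%R; rewrite powzD; exact: coset_mul.
exists (- m)%R; have := coset_powz (-1) sV my.
by rewrite -powzM mulrN1 !powzN powz1.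
Qed.

Lemma cyc_join_sub x V : V `<=` cyc_join x V.
Proof. by move=> y Vy; exists 0%R; rewrite tg_inv1 tg_mul1g. Qed.

Lemma compact_cyc_join x V : compact (closure (cyc x)) -> subgroup V -> open V -> compact V ->
  compact (cyc_join x V).
Proof.
move=> cx sV oV cV.
have -> : cyc_join x V = (fun z : Q * Q => z.1 * z.2) @` (closure (cyc x) `*` V).
  apply/seteqP; split=> [y [n Vy]|_ [[a v] [/= xa Vv] <-]].
    by exists (x ^ n, (x ^ n)^-1 * y); rewrite /= ?tg_mulVKg //; split => //; exact: ccyc_powz.
  have [_ [[n ->] Va]] := xa _ (nbhs_translate a (open_nbhs_nbhs (conj oV (subgroup1 sV)))).
  exists n; apply: (subgroup_coset_trans sV (subgroup_coset_sym sV Va)).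
  by rewrite tg_mulKg.
apply: continuous_compact; last exact: compact_setX.
by apply: continuous_subspaceT => z; exact: tg_mul_cont.
Qed.

Hypothesis hQ : hausdorff_space Q.
Hypothesis piQ : pi_procyclic_in [set: Q].

Let cK x : compact (closure (cyc x)).
Proof. by have [_ [_ /(_ x I) + _]] := piQ; rewrite /closure_in setIT. Qed.

(** Subgroups of cyclic groups are cyclic, modulo [V]: with [b] generating the p-component and [r]
    its order modulo $TV$, an element of [T] congruent to $b^r$ generates [T]. *)
Lemma primary_sub_gen p T V : prime p -> subgroup T -> T `<=` primary_comp p [set: Q] ->
  subgroup V -> nbhs (1 : Q) V -> exists2 y, T y & T `<=` cyc_join y V.
Proof.
move=> pp sT Tp sV V1; have [b pb bP] := primary_comp_gen hQ piQ pp.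
pose W := [set x | exists2 t, T t & V (x^-1 * t)].
have sW : subgroup W.
  split; first by exists 1; [exact: subgroup1 | rewrite tg_mulVg; exact: subgroup1].
  split=> [x y [t Tt Vt] [u Tu Vu]|x [t Tt Vt]].
    by exists (t * u); [exact: subgroupM | exact: coset_mul].
  exists t^-1; first exact: subgroupV.
  by have := coset_powz (-1) sV Vt; rewrite !powzN !powz1.
have [j /(_ 1%R)] := (primary_comp_setT hQ piQ b pp).1 pb V V1.
rewrite mulr1 => Vj.
have pj0 : (0 < p ^ j)%N by rewrite expn_gt0 prime_gt0.
have Wj : W (b ^ (p ^ j)%N).
  by exists 1; [exact: subgroup1 | rewrite tg_mulg1; exact: subgroupV].
have [r r0 rP] := cyc_order sW pj0 Wj.
have [t Tt Vt] : W (b ^ r) by rewrite rP.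
exists t => // z Tz; have [n bz] := bP V sV V1 z (Tp z Tz).
have /rP/dvdzP[q nE] : W (b ^ n) by exists z.
exists q; apply: (subgroup_coset_trans sV _ bz); apply: subgroup_coset_sym => //.
by rewrite nE mulrC powzM; exact: coset_powz.
Qed.

(** The product of the [y p] works, since Chinese remainders extract each factor modulo [V]. The
    exponent [m] records that the primes not yet treated are coprime to the order reached so far. *)
Lemma simultaneous_gen U V (ps : seq nat) (y : nat -> Q) : subgroup U -> subgroup V ->
  uniq ps -> (forall p, p \in ps -> prime p /\ U (y p)) ->
  (forall p, p \in ps -> exists j : nat, V (y p ^ (p ^ j)%N)) ->
  exists x, [/\ U x, exists2 m : nat, V (x ^ m) &
       forall p, prime p -> p \notin ps -> coprime p m &
     forall p, p \in ps -> cyc_join x V (y p)].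
Proof.
move=> sU sV; elim: ps => [_ _ _|p ps IH /= /andP[pps ups] Uy Vy].
  exists 1; split => //; first exact: subgroup1.
  by exists 1%N => [|p _ _]; [rewrite powz1; exact: subgroup1 | rewrite coprimen1].
have [||x [Ux [m Vm mP] xP]] := IH ups.
- by move=> q qps; apply: Uy; rewrite inE qps orbT.
- by move=> q qps; apply: Vy; rewrite inE qps orbT.
have [pp Uyp] := Uy p (mem_head _ _).
have [j Vj] := Vy p (mem_head _ _).
have co : coprime m (p ^ j) by rewrite coprimeXr // coprime_sym mP.
have V1 : V 1 := subgroup1 sV.
have powV z (c d : nat) : V (z ^ d) -> (c = 0 %[mod d])%N -> V (1^-1 * z ^ c).
  move=> Vz; rewrite mod0n => /eqP/dvdnP[q ->].
  by rewrite tg_inv1 tg_mul1g PoszM mulrC powzM; exact: (subgroup_powz _ sV Vz).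
have pow1 z (c d : nat) : V (z ^ d) -> (c = 1 %[mod d])%N -> V (z^-1 * z ^ c).
  move=> Vz cd; have : (d%:Z %| (c%:Z - 1%N%:Z)%R)%Z by rewrite -eqz_mod_dvd !modz_nat cd.
  move=> /dvdzP[q qE]; have -> : (c%:Z = 1 + d%:Z * q)%R by lia.
  by rewrite powzD powz1 tg_mulKg powzM; exact: subgroup_powz.
have V1p : V (y p ^ (p ^ j)%N) by [].
exists (x * y p); split.
- exact: subgroupM.
- exists (m * p ^ j)%N.
    rewrite powzMl // PoszM; apply: subgroupM => //.
      by rewrite powzM; exact: subgroup_powz.
    by rewrite mulrC powzM; exact: subgroup_powz.
  move=> q pq; rewrite inE negb_or => /andP[qp qps].
  rewrite coprimeMr mP // coprimeXr // prime_coprime // dvdn_prime2 //.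
move=> q; rewrite inE => /orP[/eqP ->|qps].
  exists (chinese m (p ^ j) 0 1).
  apply: subgroup_coset_sym => //; rewrite powzMl // -{1}(tg_mul1g (y p)).
  apply: coset_mul => //; first exact: powV Vm (chinese_modl co 0 1).
  exact: pow1 Vj (chinese_modr co 0 1).
have [c Vc] := xP q qps.
exists ((chinese m (p ^ j) 1 0)%:Z * c)%R; apply: (subgroup_coset_trans sV _ Vc).
apply: subgroup_coset_sym => //; rewrite powzM; apply: coset_powz => //.
rewrite powzMl // -{1}(tg_mulg1 x).
apply: coset_mul => //; first exact: pow1 Vm (chinese_modl co 1 0).
exact: powV Vj (chinese_modr co 1 0).
Qed.

(** The sets [X V] of generators modulo [V] are closed and directed, so by compactness it is enough
    that none is empty. Modulo [V] the group has a finite exponent [n], and only the p-components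
    with [p] dividing [n] have to be combined. *)
Lemma exists_generator U : compact U -> subgroup U -> exists x, generates U x.
Proof.
move=> cU sU; have clU : closed U by exact: compact_closed.
pose X V := [set x | U x /\ U `<=` cyc_join x V].
have X0 V : subgroup V -> nbhs (1 : Q) V -> X V !=set0.
  move=> sV V1; have [n n0 nP] := compact_exponent QC cU sU sV V1.
  have /choice[y yP] : forall p, exists y, prime p ->
      [/\ U y, primary_comp p [set: Q] y & U `&` primary_comp p [set: Q] `<=` cyc_join y V].
    move=> p; have [pp|np] := boolP (prime p); last by exists 1.
    have [||y [Uy py] yT] := @primary_sub_gen p (U `&` primary_comp p [set: Q]) V pp _ _ sV V1.
    - by apply: subgroupI => //; exact: subgroup_primary_comp.
    - by move=> y [].
    by exists y.
  have [||x [Ux _ xP]] := @simultaneous_gen U V (primes n) y sU sV (primes_uniq n).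
  - by move=> p; rewrite mem_primes => /and3P[pp _ _]; have [] := yP p pp.
  - move=> p; rewrite mem_primes => /and3P[pp _ _]; have [_ py _] := yP p pp.
    have [j /(_ 1%R)] := (primary_comp_setT hQ piQ _ pp).1 py V V1.
    by rewrite mulr1 => ?; exists j.
  exists x; split => // z Uz.
  have sS := subgroup_cyc_join x sV.
  apply: (dense_component_sub hQ piQ sS _ n0).
  - by apply: filterS V1; exact: cyc_join_sub.
  - by apply: cyc_join_sub; exact: nP.
  move=> p w pp pn pw zw; have [_ _ /(_ w)] := yP p pp.
  case=> [|i Vi].
    by split => //; apply: (ccyc_sub sU clU Uz).
  have pn' : p \in primes n by rewrite mem_primes pp n0.
  have Syp := xP p pn'.
  apply: (subgroup_mem_coset sS (subgroup_powz i sS Syp)).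
  exact: cyc_join_sub.
apply: contrapT => nx.
have [|||||_ [V [sV V1] <-]] := @compact_directed Q U [set X V | V in [set V | subgroup V /\ nbhs (1 : Q) V]] set0 cU.
- by exists (X [set: Q]), [set: Q] => //; split; [split | exact: filterT].
- move=> _ [V [sV V1] <-]; split; last by move=> x [].
  move=> x xcl; split; first by apply: clU; apply: closureS xcl => y [].
  have [z [[Uz zV] /= Vz]] := xcl _ (nbhs_translate x V1).
  move=> y /zV[n Vn]; exists n.
  by apply: (subgroup_coset_trans sV _ Vn); exact: coset_powz.
- move=> _ _ [V [sV V1] <-] [W [sW W1] <-]; exists (X (V `&` W)).
    by exists (V `&` W) => //; split; [exact: subgroupI | exact: filterI].
  by move=> x [Ux xVW]; split; split => // y /xVW[n []]; exists n.
- exact: open0.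
- move=> x xX; apply: nx; exists x.
  have [Ux _] : X [set: Q] x by apply: xX; exists [set: Q] => //; split; [split | exact: filterT].
  by split => // V sV V1; have [] : X V x by apply: xX; exists V.
by have [x /[swap]/[apply]] := X0 V sV V1.
Qed.

Lemma generates_ccyc U x : closed U -> subgroup U -> generates U x -> closure (cyc x) = U.
Proof.
move=> cU sU [Ux xU]; apply/seteqP; split; first exact: ccyc_sub.
move=> y Uy O /nbhs_translate1 /(pi_procyclic_basis hQ piQ)[W [sW oW _ WO]].
have [|n Wn] := xU W sW _ y Uy.
  by apply: open_nbhs_nbhs; split => //; exact: subgroup1.
exists (x ^ n); split; first by exists n.
by have := WO _ (subgroup_coset_sym sW Wn); rewrite /= tg_mulVKg.
Qed.

(** From a compact open [W] on, stage [p] adjoins a generator of the p-component modulo the subgroup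
    reached; at non-prime [p] an arbitrary element is adjoined, which does no harm. If $x^k$ lies in
    [W], only the components for primes dividing [k] matter, and these are present in [U k.+1]. *)
Lemma procyclic_chain : exists U : nat -> set Q,
  [/\ forall i, [/\ subgroup (U i), open (U i) & compact (U i)],
      forall i j, (i <= j)%N -> U i `<=` U j,
      forall x, exists i, U i x &
      forall p, prime p -> primary_comp p [set: Q] `<=` U p.+1].
Proof.
have [W [sW oW cW _]] := pi_procyclic_basis hQ piQ (filterT : nbhs (1 : Q) setT).
have /choice[b bP] : forall p, exists b, prime p ->
    forall V, subgroup V -> nbhs (1 : Q) V -> primary_comp p [set: Q] `<=` cyc_join b V.
  move=> p; have [pp|np] := boolP (prime p); last by exists 1.
  by have [b _ bP] := primary_comp_gen hQ piQ pp; exists b.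
pose U := fix U (i : nat) := if i is j.+1 then cyc_join (b j) (U j) else W.
have UP i : [/\ subgroup (U i), open (U i) & compact (U i)].
  elim: i => [//|i [sU oU cU]] /=; have sU' := subgroup_cyc_join (b i) sU.
  split => //; last exact: compact_cyc_join.
  apply: open_subgroup => //; apply: filterS (@cyc_join_sub (b i) (U i)) _.
  by apply: open_nbhs_nbhs; split => //; exact: subgroup1.
have Ule i j : (i <= j)%N -> U i `<=` U j.
  move=> /subnKC <-; elim: (j - i)%N => [|d IH]; first by rewrite addn0.
  by rewrite addnS; apply: subset_trans IH _; exact: cyc_join_sub.
have U1 i : nbhs (1 : Q) (U i).
  by have [sU oU _] := UP i; apply: open_nbhs_nbhs; split => //; exact: subgroup1.
have pU p : prime p -> primary_comp p [set: Q] `<=` U p.+1.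
  by move=> pp; have [sU _ _] := UP p; exact: bP.
exists U; split => // x.
have [k k0 Wk] := compact_power (@cK x) (@ccyc_powz _ x) sW (U1 0%N).
have [sU oU _] := UP k.+1; exists k.+1.
apply: (dense_component_sub hQ piQ sU (U1 _) k0); first exact: (Ule 0%N).
move=> p y pp pk py _; apply: (Ule p.+1); first by rewrite ltnS dvdn_leq.
exact: pU.
Qed.

End Chain.

(** * Monothetic groups *)

Section Monothetic.
Variable B : TopGroup.
Implicit Types (x y z : B) (S V U K N : set B).
Hypothesis hB : hausdorff_space B.

Lemma commuting_coset_powz V x y (n : int) : subgroup V -> x * y = y * x ->
  V (x^-1 * y) -> V ((x ^ n)^-1 * y ^ n).
Proof.
move=> sV xy Vx; have -> : (x ^ n)^-1 * y ^ n = (x^-1 * y) ^ n.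
  have e : x^-1 = x ^ (-1) by rewrite powzN powz1.
  rewrite powzMl; first by rewrite e -powzM mulN1r powzN.
  by apply: (@tg_mulgI _ x); rewrite tg_mulVKg tg_mulA xy tg_mulgK.
exact: subgroup_powz.
Qed.

Lemma ccyc_morph x y (n : int) : closure (cyc x) y -> closure (cyc (x ^ n)) (y ^ n).
Proof.
move=> xy; suff : cyc x `<=` [set z | closure (cyc (x ^ n)) (z ^ n)].
  move=> /closureS h; have := h y xy; rewrite -(closure_id _).1 //.
  by apply: ((continuous_closedP _).1 (@continuous_powz B n) _); exact: closed_closure.
by move=> _ [m ->] /=; rewrite -powzM mulrC powzM; exact: ccyc_powz.
Qed.

Lemma nbhs1_eq x : (forall V, nbhs (1 : B) V -> V x) -> x = 1.
Proof.
move=> xV; apply: contrapT => x1; have := xV (~` [set x]) _; apply => //.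
apply: open_nbhs_nbhs; split; last by move=> /esym.
by apply: closed_openC; exact: closed_set1.
Qed.

(** The subgroup has finite index: its complement in the closure of [cyc x] is covered by finitely
    many closed cosets. The second clause of [D i] discards those equal to the subgroup itself. *)
Lemma ccyc_open x (d : nat) : (0 < d)%N ->
  exists2 O : set B, open O & closure (cyc (x ^ d)) = O `&` closure (cyc x).
Proof.
move=> d0; set P := closure (cyc (x ^ d)).
have sP : subgroup P by exact: subgroup_ccyc.
have cP : closed P by exact: closed_closure.
pose D (i : nat) := [set z | P ((x ^ i)^-1 * z) /\ ~ P (x ^ i)].
have cD i : closed (D i).
  have [Pi|nPi] := pselect (P (x ^ i)).
    have -> : D i = set0 by apply/seteqP; split => // z [].
    exact: closed0.
  have -> : D i = [set z | P ((x ^ i)^-1 * z)] by apply/seteqP; split => z // [].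
  exact: closed_coset.
exists (~` (\bigcup_(i < d) D i)).
  by apply: closed_openC; rewrite bigcup_mkord; apply: closed_bigsetU.
apply/seteqP; split=> z.
  move=> Pz; split.
    move=> [i /= id [Piz nPi]]; apply: nPi; apply: (subgroup_mem_coset sP Pz).
    exact: (subgroup_coset_sym sP).
  move: Pz; apply: (ccyc_sub (@subgroup_ccyc _ x) (@closed_closure _ _)).
  exact: ccyc_powz.
move=> [nD xz]; have [i id] := ccyc_split d0 xz; rewrite powzN => Pi.
have Pxi : P (x ^ i) by apply: contrapT => nP; apply: nD; exists i.
exact: (subgroup_mem_coset sP Pxi).
Qed.

Lemma profinite_type_ccyc x V : profinite_type x -> nbhs (1 : B) V ->
  exists2 d : nat, (0 < d)%N & closure (cyc (x ^ d)) `<=` V.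
Proof.
move=> px /nbhs1_closure[W [oW W1] WV].
have [d d0 dP] := px W (open_nbhs_nbhs (conj oW W1)); exists d => //.
apply: subset_trans WV; apply: closureS => _ [n ->].
by rewrite -powzM.
Qed.

Lemma p_type_small p x V : p_type p x -> nbhs (1 : B) V ->
  exists j : nat, closure (cyc (x ^ (p ^ j)%N)) `<=` V.
Proof.
move=> px /nbhs1_closure[W [oW W1] WV].
have [j jP] := px W (open_nbhs_nbhs (conj oW W1)); exists j.
by apply: subset_trans WV; apply: closureS => _ [n ->]; rewrite -powzM.
Qed.

Lemma Zp_set_mod p (z : Zp_carrier) : Zp_set p z ->
  forall n m : nat, (n <= m)%N -> (z m %% p ^ n)%N = z n.
Proof.
move=> Zz n m /subnKC <-; elim: (m - n)%N => [|d IH].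
  by rewrite addn0 modn_small //; have [] := Zz n.
rewrite addnS -IH -(modn_dvdm (z (n + d).+1) (_ : p ^ n %| p ^ (n + d))%N).
  by have [_ ->] := Zz (n + d)%N.
by rewrite dvdn_exp2l // leq_addr.
Qed.

(** Suppose there are windows of every length without return times, and let [l] be a limit of the
    powers at their centres. Some $x^i$ is close to $l^{-1}$, so shifting the centre by [i] gives a
    return, still inside the window once $|i| < L$. *)
Lemma syndetic_return x K V : compact K -> (forall n : int, K (x ^ n)) -> nbhs (1 : B) V ->
  syndetic [set n | V (x ^ n)].
Proof.
move=> cK Kx V1; apply: contrapT => ns.
have /choice[w wP] : forall L : nat, exists w : int, forall i : nat, (i < L)%N -> ~ V (x ^ (w + i%:Z)).
  move=> L; apply: contrapT => nw; apply: ns; exists L => w.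
  apply: contrapT => ni; apply: nw; exists w => i iL Vi; apply: ni; by exists i.
have [F FU Foo] := free_ultrafilter.
pose y L := (w L.*2 + L%:Z)%R.
have [|l _ yl] := @ultra_cvg_compact _ _ F K (fun L => x ^ (y L)) FU cK.
  by apply: filterS filterT => n _; exact: Kx.
have xl : closure (cyc x) l.
  apply: (closed_cvg _ (@closed_closure _ (cyc x)) _ _ yl).
  by apply: nearW => n; exact: ccyc_powz.
have xl' : closure (cyc x) l^-1 by apply: (subgroupV (@subgroup_ccyc _ x)).
have Vl : nbhs l^-1 [set z | V° (l * z)].
  apply: (@continuous_mull _ l l^-1); rewrite tg_mulgV.
  by apply: open_nbhs_nbhs; split => //; exact: open_interior.
have [_ [[i ->] /= Vi]] := xl' _ Vl.
have yi : (fun L => x ^ (y L + i)) @ F --> l * x ^ i.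
  by under eq_fun do rewrite powzD; apply: cvg_tg_mul => //; exact: cvg_cst.
have FV : F [set L | V (x ^ (y L + i))] := yi _ Vi.
have FL : F [set L | (`|i| < L)%N] by apply: Foo; exists `|i|.+1.
have [L [/= LV Li]] := filter_ex (filterI FV FL).
have [|] := wP L.*2 `|(L%:Z + i)%R|%N; first by lia.
by rewrite (_ : (_ + _ = y L + i)%R) // /y; lia.
Qed.

(** * Monothetic pro-p groups are finite cyclic or p-adic integers *)

Section PAdic.
Variables (p : nat) (x : B).
Hypothesis pp : prime p.
Hypothesis cx : compact (closure (cyc x)).
Hypothesis px : p_type p x.

Let S := closure (cyc x).
Let V (n : nat) := closure (cyc (x ^ (p ^ n)%N)).
Let sS : subgroup S. Proof. exact: subgroup_ccyc. Qed.
Let sV n : subgroup (V n). Proof. exact: subgroup_ccyc. Qed.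
Let pn0 n : (0 < p ^ n)%N. Proof. by rewrite expn_gt0 prime_gt0. Qed.
Let SC a b : S a -> S b -> a * b = b * a. Proof. exact: ccyc_comm. Qed.

Let Vle m n : (m <= n)%N -> V n `<=` V m.
Proof.
move=> mn; apply: (ccyc_sub (sV m) (@closed_closure _ _)).
by rewrite -(subnKC mn) expnD PoszM powzM; exact: ccyc_powz.
Qed.

Let V_eq a b : (forall n, V n (a^-1 * b)) -> a = b.
Proof.
move=> ab; apply/esym; apply: (@tg_mulgI _ a^-1); rewrite tg_mulVg.
apply: nbhs1_eq => W /(p_type_small px)[j jW]; apply: jW; exact: ab.
Qed.

Lemma p_torsion_finite_cyclic k : x ^ (p ^ k)%N = 1 -> finite_cyclic_pgroup p S.
Proof.
move=> xk; exists x, k; split; last by [].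
apply/seteqP; split; last exact: subset_closure.
move=> y Sy; have [i _] := ccyc_split (pn0 k) Sy.
have -> : closure (cyc (x ^ (p ^ k)%N)) = [set 1].
  rewrite xk [RHS](closure_id _).1; last exact: closed_set1.
  congr closure; apply/seteqP; split=> [_ [n ->]|_ ->]; first exact: pow1z.
  exact: cyc_id.
move=> h; exists (Posz i); apply: (@tg_mulgI _ (x ^ (- i%:Z))).
by rewrite h -powzD addNr.
Qed.

Hypothesis xinf : forall k, x ^ (p ^ k)%N <> 1.

(** The filtration does not stall: if [x] had order $p^m$ with $m < n$ modulo [V n], then $y =
    x^{p^m}$ would lie in the closed subgroup generated by $y^p$, by iteration in that of each
    $y^{p^j}$, and so equal 1. *)
Let V_dvd n (i : int) : V n (x ^ i) -> ((p ^ n)%N%:Z %| i)%Z.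
Proof.
have Vn : V n (x ^ (p ^ n)%N) by exact: ccyc_id.
have [r r0 rP] := cyc_order (sV n) (pn0 n) Vn.
have := (rP _).1 Vn; rewrite dvdzE /= => /(dvdn_pfactor _ _ pp)[m mn rE].
suff : (n <= m)%N.
  move=> nm Vi; apply: dvdz_trans (_ : (r%:Z %| i)%Z); last exact/rP.
  by rewrite dvdzE /= rE dvdn_exp2l.
rewrite leqNgt; apply/negP => mn'.
apply: (xinf (k := m)); set y := x ^ _.
have y1 : closure (cyc (y ^ p)) y.
  have Vr : V n (x ^ r) by apply/rP.
  have := Vle mn' (_ : V n y); rewrite /V expnS mulnC PoszM powzM; apply.
  by rewrite /y -rE.
have yj (j : nat) : closure (cyc (y ^ (p ^ j)%N)) y.
  elim: j => [|j IH]; first by rewrite expn0 powz1; exact: ccyc_id.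
  have h := @ccyc_morph _ _ (p ^ j)%N y1.
  move: IH; apply: (ccyc_sub (@subgroup_ccyc _ _) (@closed_closure _ _)).
  by rewrite expnS PoszM powzM.
apply: nbhs1_eq => W /(p_type_small (p_type_powz (p ^ m)%N px))[j jW].
exact: jW.
Qed.

Let coset_uniq n (i j : nat) y : (i < p ^ n)%N -> (j < p ^ n)%N ->
  V n ((x ^ i)^-1 * y) -> V n ((x ^ j)^-1 * y) -> i = j.
Proof.
move=> ip jp Vi Vj.
have : V n ((x ^ i)^-1 * x ^ j).
  by apply: (subgroup_coset_trans (sV n) Vi); exact: (subgroup_coset_sym (sV n)).
rewrite -powzN -powzD => /V_dvd.
have e : (- i%:Z + j%:Z = j%:Z - i%:Z)%R by rewrite addrC.
rewrite e -eqz_mod_dvd !modz_nat eqz_nat !modn_small //.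
by move=> /eqP.
Qed.

Let mod_coset n (i j : nat) : (i = j %[mod p ^ n])%N -> V n ((x ^ i)^-1 * x ^ j).
Proof.
move=> ij; have : ((p ^ n)%N%:Z %| (j%:Z - i%:Z)%R)%Z.
  by rewrite -eqz_mod_dvd !modz_nat ij.
move=> /dvdzP[q qE]; rewrite -powzN -powzD addrC qE mulrC powzM.
exact: ccyc_powz.
Qed.

(** [f y] lists the residues [i] with [y] in $x^i V_n$, unique because [x] has order exactly $p^n$
    modulo $V_n$; [g z] is a limit of the powers of [x] with exponents the residues of [z]. *)
Lemma p_nontorsion_iso_Zp : iso_Zp p S.
Proof.
have cV n : closed (V n) by exact: closed_closure.
have /choice[f fP] : forall y, exists z : Zp_carrier, S y ->
    forall n, (z n < p ^ n)%N /\ V n ((x ^ (z n))^-1 * y).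
  move=> y; have [Sy|nSy] := pselect (S y); last by exists (fun=> 0%N).
  have /choice[z zP] : forall n, exists i : nat, (i < p ^ n)%N /\ V n ((x ^ i)^-1 * y).
    by move=> n; have [i ip] := ccyc_split (pn0 n) Sy; rewrite powzN => h; exists i.
  by exists z.
have fZ y : S y -> Zp_set p (f y).
  move=> Sy n; have [fn Vn] := fP y Sy n; have [fn1 Vn1] := fP y Sy n.+1.
  split => //; apply: (@coset_uniq n _ _ y) => //; first by rewrite ltn_mod.
  apply: (subgroup_coset_trans (sV n) _ (Vle (leqnSn n) Vn1)).
  by apply: mod_coset; rewrite modn_mod.
have /choice[g gP] : forall z : Zp_carrier, exists y, Zp_set p z ->
    S y /\ forall n, V n ((x ^ (z n))^-1 * y).
  move=> z; have [Zz|nZ] := pselect (Zp_set p z); last by exists 1.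
  have [F FU Foo] := free_ultrafilter.
  have [|y Sy zy] := @ultra_cvg_compact _ _ F S (fun m : nat => x ^ (z m)) FU cx.
    by apply: filterS filterT => m _; exact: ccyc_powz.
  exists y => _; split => // n.
  apply: (closed_cvg [set y | V n ((x ^ (z n))^-1 * y)] _ _ _ zy); first exact: closed_coset.
  have : F [set m | (n <= m)%N] by apply: Foo; exists n.
  apply: filterS => m nm /=; apply: mod_coset.
  by rewrite (Zp_set_mod Zz nm) modn_small //; have [] := Zz n.
exists f, g; split; split => //.
- by move=> z /gP[].
- move=> y Sy; have [Sg Vg] := gP _ (fZ y Sy).
  apply/esym; apply: V_eq => n; have [_ Vn] := fP y Sy n.
  by apply: (subgroup_coset_trans (sV n) (subgroup_coset_sym (sV n) Vn)).
- move=> z Zz; have [Sg Vg] := gP _ Zz; apply/funext => n.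
  have [fn Vn] := fP _ Sg n; apply: (coset_uniq fn _ Vn (Vg n)).
  by have [] := Zz n.
- move=> a b Sa Sb; apply/funext => n; rewrite /Defs.Zp_add.
  have [fa Va] := fP _ Sa n; have [fb Vb] := fP _ Sb n.
  have [fab Vab] := fP _ (subgroupM sS Sa Sb) n.
  apply: (coset_uniq fab _ Vab); first by rewrite ltn_mod.
  have h : V n ((x ^ (f a n + f b n)%N)^-1 * (a * b)).
    have -> : (x ^ (f a n + f b n)%N)^-1 * (a * b) =
        ((x ^ (f a n))^-1 * a) * ((x ^ (f b n))^-1 * b).
      rewrite PoszD powzD powz_comm tg_invM -!tg_mulA; congr (_ * _).
      rewrite !tg_mulA; congr (_ * _); apply: SC => //.
      by apply: (subgroupV sS); exact: ccyc_powz.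
    exact: (subgroupM (sV n)).
  by apply: (subgroup_coset_trans (sV n) _ h); apply: mod_coset; rewrite modn_mod.
- apply/subspace_continuousP => a Sa; apply/(@pointwise_cvgP nat nat) => n.
  apply: cvg_near_cst.
  have [O oO VE] := @ccyc_open x _ (pn0 n).
  have O1 : nbhs (1 : B) O.
    apply: open_nbhs_nbhs; split => //.
    by have := subgroup1 (sV n); rewrite /V VE => -[].
  apply: filterS (nbhs_translate a O1) => b Ob Sb.
  have Vab : V n (a^-1 * b).
    rewrite /V VE; split => //; apply: (subgroupM sS) => //; exact: (subgroupV sS).
  have [fa Va] := fP _ Sa n; have [fb Vb] := fP _ Sb n.
  by apply: (coset_uniq fb fa Vb); exact: (subgroup_coset_trans (sV n) _ Vab).
- apply/subspace_continuousP => z Zz W /nbhs_translate1 /(p_type_small px)[n nW].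
  have zn : nbhs z [set w : Zp_carrier | w n = z n].
    have /(_ z [set k | k = z n]) := @proj_continuous nat (fun=> nat) n; apply.
    exact: discrete_set1.
  apply: filterS zn => w wz Zw /=.
  have [_ /(_ n) Vw] := gP _ Zw; have [_ /(_ n) Vz] := gP _ Zz.
  have h : V n ((g z)^-1 * g w).
    by rewrite wz in Vw; exact: (subgroup_coset_trans (sV n) (subgroup_coset_sym (sV n) Vz)).
  by have := nW _ h; rewrite /= tg_mulVKg.
Qed.

End PAdic.

Lemma p_type_ccyc_structure p x : prime p -> compact (closure (cyc x)) -> p_type p x ->
  finite_cyclic_pgroup p (closure (cyc x)) \/ iso_Zp p (closure (cyc x)).
Proof.
move=> pp cx px; have [[k xk]|nk] := pselect (exists k, x ^ (p ^ k)%N = 1).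
  by left; exact: p_torsion_finite_cyclic xk.
by right; apply: p_nontorsion_iso_Zp => // k xk; apply: nk; exists k.
Qed.

End Monothetic.

(** * Lifting to the extension *)

From mathcomp Require Import Rstruct.

Section Quotient.
Variables (G Q : TopGroup) (A : set G) (pi : G -> Q).
Implicit Types (x y z : G) (K : set Q).
Hypothesis hG : hausdorff_space G.
Hypothesis cA : compact A.
Hypothesis piM : {morph pi : x y / x * y >-> x * y}.
Hypothesis pi_cont : continuous pi.
Hypothesis pi_open : forall U : set G, open U -> open (pi @` U).
Hypothesis pi_surj : forall q : Q, exists x, pi x = q.
Hypothesis pi_ker : forall x, pi x = 1 <-> A x.

Lemma quotient_hausdorff : hausdorff_space Q.
Proof.
have [pi1 piV _] := morph_powz piM.
move=> p q pq; have [g gE] := pi_surj (p^-1 * q).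
apply: contrapT => npq.
have nAg : ~ A g.
  move=> /pi_ker; rewrite gE => h; apply: npq.
  by apply: (@tg_mulgI _ p^-1); rewrite tg_mulVg h.
have oN : nbhs (1 : G) [set v | ~ A (g * v)].
  apply: (@continuous_mull _ g 1 (~` A)); rewrite tg_mulg1.
  by apply: open_nbhs_nbhs; split => //; apply: closed_openC; exact: compact_closed.
have [W [oW W1 WV WW]] := nbhs1_split oN.
have piW : nbhs (1 : Q) (pi @` W).
  by apply: open_nbhs_nbhs; split; [exact: pi_open | exists 1].
have [z [/= [w Ww wE] [w' Ww' wE']]] := pq _ _ (nbhs_translate p piW) (nbhs_translate q piW).
apply: (WW w' w^-1) => //; first exact: WV.
apply/pi_ker; rewrite !piM piV wE wE' gE tg_invM tg_invK.
by rewrite -!tg_mulA tg_mulVKg tg_mulVKg tg_mulVg.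
Qed.

(** If [g] lies over a cluster point [q] of the image filter, the given filter accumulates at the
    coset $gA$. Pulling it back to [A], up to small left factors [w], gives a filter with a cluster
    point [a], and $ga$ is the point sought. *)
Lemma quotient_preimage_compact K : compact K -> compact (pi @^-1` K).
Proof.
have [pi1 piV _] := morph_powz piM.
move=> cK F FF FK; have [q [Kq qcl]] := cK (pi @ F) _ FK.
have [g gE] := pi_surj q.
pose T (SW : set G * set G) := [set a | A a /\ exists2 w, SW.2 w & SW.1 (w * (g * a))].
pose D := [set SW : set G * set G | F SW.1 /\ nbhs (1 : G) SW.2].
have TF : ProperFilter (filter_from D T).
  apply: filter_from_proper; last first.
    move=> [S W] [/= FS W1].
    have nW : nbhs (1 : G) W° by exact: nbhs_interior.
    have oW : open (pi @` W°) by apply: pi_open; exact: open_interior.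
    have Wq : nbhs q [set z | (pi @` W°) (z * q^-1)].
      apply: (@continuous_mulr _ q^-1 q); rewrite tg_mulgV.
      by apply: open_nbhs_nbhs; split => //; exists 1 => //; exact: nbhs_singleton.
    have FpS : F [set x | (pi @` S) (pi x)] by apply: filterS FS => x Sx; exists x.
    have [_ [[x Sx <-] /= [w Ww wE]]] := qcl _ _ FpS Wq.
    exists ((w * g)^-1 * x); split.
      apply/pi_ker; rewrite piM piV piM wE gE.
      by rewrite tg_mulgVK tg_mulVg.
    by exists w; [exact: interior_subset | rewrite /= [w * _]tg_mulA tg_mulVKg].
  apply: filter_from_filter; first by exists (setT, setT); split; exact: filterT.
  move=> [S W] [S' W'] [/= FS W1] [/= FS' W1']; exists (S `&` S', W `&` W').
    by split; exact: filterI.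
  by move=> a [/= Aa [w [Ww Ww'] [Sw Sw']]]; split; split => //; exists w.
have TA : filter_from D T A.
  by exists (setT, setT) => [|a []//]; split; exact: filterT.
have [a [Aa acl]] := cA TF TA.
exists (g * a); split; first by rewrite /= piM gE ((pi_ker a).2 Aa) tg_mulg1.
move=> S N FS Nga.
have : nbhs ((1, a) : G * G) [set z | N (z.1 * (g * z.2))].
  have h : (fun z : G * G => z.1 * (g * z.2)) @ nbhs ((1, a) : G * G) --> 1 * (g * a).
    apply: cvg_tg_mul; first exact: cvg_fst.
    by apply: cvg_tg_mul; [exact: cvg_cst | exact: cvg_snd].
  by apply: h; rewrite tg_mul1g.
case=> -[W W'] /= [W1 W'a] WN.
have FT : filter_from D T (T (S, W)) by exists (S, W).
have [a' [[_ [w Ww /= Sw]] W'a']] := acl _ _ FT W'a.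
by exists (w * (g * a')); split => //; exact: (WN (w, a')).
Qed.

End Quotient.

(** * Compatible towers of lifted generators *)

Section Lifting.
Variables (G Q : TopGroup) (pi : G -> Q) (U : nat -> set Q).
Implicit Types (V : set Q).
Hypothesis hG : hausdorff_space G.
Hypothesis hQ : hausdorff_space Q.
Hypothesis piM : {morph pi : x y / x * y >-> x * y}.
Hypothesis pi_cont : continuous pi.
Hypothesis pi_surj : forall q : Q, exists x, pi x = q.
Hypothesis pi_proper : forall K, compact K -> compact (pi @^-1` K).
Hypothesis piQ : pi_procyclic_in [set: Q].
Hypothesis UP : forall i, [/\ subgroup (U i), open (U i) & compact (U i)].
Hypothesis Ule : forall i j, (i <= j)%N -> U i `<=` U j.

Let QC (x y : Q) : x * y = y * x.
Proof. by have [[_ + _] _] := piQ; apply. Qed.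

Let U1 i : nbhs (1 : Q) (U i).
Proof. by have [sU oU _] := UP i; apply: open_nbhs_nbhs; split => //; exact: subgroup1. Qed.

Let sU i : subgroup (U i). Proof. by have [] := UP i. Qed.

Let clU i : closed (U i).
Proof. by apply: compact_closed => //; have [] := UP i. Qed.

Let cK i : compact (pi @^-1` U i).
Proof. by apply: pi_proper; have [] := UP i. Qed.

Let sK i : subgroup (pi @^-1` U i).
Proof.
have [pi1 piV _] := morph_powz piM; split; first by rewrite /= pi1; exact: subgroup1.
split=> [x y Ux Uy|x Ux] /=; first by rewrite piM; exact: subgroupM.
by rewrite piV; exact: subgroupV.
Qed.

(** Modulo [U i] any two generators are powers of each other, so their orders coincide. This
    independence is essential: the towers are limits of changing generators, and one [s] must fit
    them all. *)
Lemma generator_index i : exists2 s : nat, (0 < s)%N &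
  forall x, generates (U i.+1) x -> forall n : int, U i (x ^ n) <-> (s%:Z %| n)%Z.
Proof.
have ord x : U i.+1 x -> exists2 r : nat, (0 < r)%N & forall n : int, U i (x ^ n) <-> (r%:Z %| n)%Z.
  move=> Ux; have [_ _ cU] := UP i.+1.
  have [k k0 Uk] := compact_power cU (fun n => subgroup_powz n (sU _) Ux) (sU i) (U1 i).
  exact: cyc_order Uk.
have dvd x y (r s : nat) : generates (U i.+1) x -> U i.+1 y ->
    (forall n : int, U i (x ^ n) <-> (r%:Z %| n)%Z) ->
    (forall n : int, U i (y ^ n) <-> (s%:Z %| n)%Z) -> (s %| r)%N.
  move=> [_ xgen] Uy rP sP; have [n xy] := xgen (U i) (sU i) (U1 i) y Uy.
  have Ur : U i (x ^ r) by apply/rP.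
  suff /sP : U i (y ^ r) by rewrite dvdzE.
  apply: (subgroup_mem_coset (sU i) (subgroup_powz n (sU i) Ur)).
  by rewrite -powzM mulrC powzM; apply: coset_powz.
have [_ _ cU] := UP i.+1.
have [x gx] := exists_generator QC hQ piQ cU (sU _).
have [s s0 sP] := ord x (proj1 gx); exists s => // y gy n.
have [r r0 rP] := ord y (proj1 gy).
have sr := dvd _ _ _ _ gy (proj1 gx) rP sP.
have rs := dvd _ _ _ _ gx (proj1 gy) sP rP.
have -> : s = r by apply/eqP; rewrite eqn_dvd sr.
exact: rP.
Qed.

Lemma generates_powz i (s : nat) x : generates (U i.+1) x ->
  (forall n : int, U i (x ^ n) <-> (s%:Z %| n)%Z) -> generates (U i) (x ^ s).
Proof.
move=> [Ux xgen] sP; split; first by apply/sP.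
move=> V sV V1 y Uy.
have [n [Vn Un]] := xgen (V `&` U i) (subgroupI sV (sU i)) (filterI V1 (U1 i)) y (Ule (leqnSn i) Uy).
have /sP/dvdzP[q nE] : U i (x ^ n).
  by apply: (subgroup_mem_coset (sU i) Uy); exact: (subgroup_coset_sym (sU i)).
by exists q; rewrite -powzM mulrC -nE.
Qed.

Lemma generator_tower : exists (g : nat -> G) (s : nat -> nat),
  [/\ forall i, (0 < s i)%N, forall i, generates (U i) (pi (g i)),
      forall i, g i = g i.+1 ^ s i &
      forall i (x : Q), generates (U i.+1) x -> forall n : int, U i (x ^ n) <-> ((s i)%:Z %| n)%Z].
Proof.
have [pi1 piV piX] := morph_powz piM.
have /choice[s sP] : forall i, exists s : nat, (0 < s)%N /\
    forall x, generates (U i.+1) x -> forall n : int, U i (x ^ n) <-> (s%:Z %| n)%Z.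
  by move=> i; have [s] := generator_index i; exists s.
have /choice[x xgen] : forall N, exists x, generates (U N) (pi x).
  move=> N; have [_ _ cU] := UP N.
  have [u ugen] := exists_generator QC hQ piQ cU (sU N).
  by have [x xE] := pi_surj u; exists x; rewrite xE.
(* Each lifted generator [x N] gives a finite tower below [N] through its powers by these products;
   the limit over [N], taken at all levels along one ultrafilter, is an infinite tower. *)
pose m n N : nat := \prod_(n <= i < N) s i.
have mS n N : (n < N)%N -> m n N = (m n.+1 N * s n)%N.
  by move=> nN; rewrite /m big_ltn // mulnC.
have genm N d : generates (U (N - d)) (pi (x N ^ m (N - d)%N N)).
  elim: d => [|d IH]; first by rewrite subn0 /m big_geq // powz1.
  have [Nd|dN] := leqP N d.
    by move: IH; rewrite (_ : N - d.+1 = N - d)%N //; lia.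
  have e : (N - d = (N - d.+1).+1)%N by lia.
  rewrite mS; last by lia.
  rewrite PoszM powzM piX -e; apply: generates_powz; rewrite -?e //.
  by have [_] := sP (N - d.+1)%N; apply; rewrite -e.
have gen n N : (n <= N)%N -> generates (U n) (pi (x N ^ m n N)).
  by move=> nN; have := genm N (N - n)%N; rewrite subKn.
have [F FU Foo] := free_ultrafilter.
have Fge n : F [set N | (n <= N)%N] by apply: Foo; exists n.
have /choice[g gP] : forall n, exists l : G, (fun N => x N ^ m n N) @ F --> l.
  move=> n; have [|l _ ?] := @ultra_cvg_compact _ _ F _ (fun N => x N ^ m n N) FU (@cK n).
    by apply: filterS (Fge n) => N /= /gen[].
  by exists l.
exists g, s; split.
- by move=> i; have [] := sP i.
- move=> n.
  have cg := closed_generates QC (@clU n).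
  apply: (closed_cvg (pi @^-1` generates (U n)) _ _ _ (gP n)).
    exact: ((continuous_closedP _).1 pi_cont).
  by apply: filterS (Fge n) => N /= /gen.
- move=> n; have h : (fun N => (x N ^ m n.+1 N) ^ s n) @ F --> g n.+1 ^ s n.
    by apply: cvg_powz; exact: gP.
  apply: (cvg_unique hG (gP n)).
  apply: cvg_trans h; apply: near_eq_cvg; apply: filterS (Fge n.+1) => N /= nN.
  by rewrite (mS n N nN) PoszM powzM.
- by move=> i; have [] := sP i.
Qed.

(* Each [g i] is replaced by its limit along [torsion_ultrafilter]; this does not
   change its image in [Q] but makes the closed subgroup it generates profinite. *)
Lemma profinite_tower : exists (h : nat -> G) (s : nat -> nat),
  [/\ forall i, (0 < s i)%N, forall i, generates (U i) (pi (h i)),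
      forall i, h i = h i.+1 ^ s i, forall i, profinite_type (h i) &
      forall i (x : Q), generates (U i.+1) x -> forall n : int, U i (x ^ n) <-> ((s i)%:Z %| n)%Z].
Proof.
have [pi1 piV piX] := morph_powz piM.
have [g [s [s0 ggen gS sP]]] := generator_tower.
have [F FU [F1 FE]] := torsion_ultrafilter Rdefinitions.R.
have Kg i (n : int) : (pi @^-1` U i) (g i ^ n).
  by apply: (subgroup_powz n (@sK i)); have [] := ggen i.
have /choice[h hP] : forall i, exists l : G, (fun a : int => g i ^ a) @ F --> l.
  move=> i; have [|l _ ?] := @ultra_cvg_compact _ _ F _ (fun a : int => g i ^ a) FU (@cK i).
    by apply: filterS filterT => a _; exact: Kg.
  by exists l.
have pih i : pi (h i) = pi (g i).
  have h1 : (fun a : int => pi (g i) ^ a) @ F --> pi (h i).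
    under eq_fun do rewrite -piX; apply: continuous_cvg; last exact: hP.
    exact: pi_cont.
  apply: (cvg_unique hQ h1) => V Vg.
  (* An exponent congruent to 1 modulo [d] keeps the power in [V], and along [F] the exponents have
     this property. *)
  have [d d0 dP] := @pi_procyclic_profinite Q hQ piQ (pi (g i)) _ (nbhs_translate1 Vg).
  suff : F [set a : int | V (pi (g i) ^ a)] by [].
  apply: filterS (F1 d d0) => a /dvdzP[q qE] /=.
  have -> : (a = 1 + d%:Z * q)%R by lia.
  by rewrite powzD powz1; exact: dP.
exists h, s; split => //.
- by move=> i; rewrite pih.
- move=> i; have h1 : (fun a : int => (g i.+1 ^ a) ^ s i) @ F --> h i.+1 ^ s i.
    by apply: cvg_powz; exact: hP.
  apply: (cvg_unique hG (hP i)); apply: cvg_trans h1; apply: near_eq_cvg; apply: nearW => a /=.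
  by rewrite (gS i) -!powzM mulrC.
move=> i V /nbhs1_closure[W [oW W1] WV].
have [W' [oW' W'1 _ WW']] := nbhs1_split (open_nbhs_nbhs (conj oW W1)).
have [Y [oY Y1 YV YY]] := nbhs1_split (open_nbhs_nbhs (conj oW' W'1)).
have [d d0 dP] := FE _ (syndetic_return (@cK i) (Kg i) (open_nbhs_nbhs (conj oY Y1))).
exists d => // t; apply: WV.
have h1 : (fun a : int => (g i ^ a) ^ (d%:Z * t)) @ F --> h i ^ (d%:Z * t).
  by apply: cvg_powz; exact: hP.
apply: (closed_cvg _ (@closed_closure _ W) _ _ h1).
have dt : (d%:Z %| (d%:Z * t)%R)%Z by rewrite dvdz_mulr.
apply: filterS (dP _ dt) => a [a1 [a2 [a3 [a4 [Y1a Y2a Y3a Y4a aE]]]]] /=.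
apply: subset_closure; rewrite -powzM mulrC aE !powzD !powzN -!tg_mulA tg_mulA.
by apply: WW'; apply: YY => //; exact: YV.
Qed.

End Lifting.

(** * The supplement *)

Section Supplement.
Variables (G Q : TopGroup) (pi : G -> Q) (U : nat -> set Q) (h : nat -> G) (s : nat -> nat).
Hypothesis hG : hausdorff_space G.
Hypothesis hQ : hausdorff_space Q.
Hypothesis piM : {morph pi : x y / x * y >-> x * y}.
Hypothesis pi_cont : continuous pi.
Hypothesis pi_proper : forall K, compact K -> compact (pi @^-1` K).
Hypothesis piQ : pi_procyclic_in [set: Q].
Hypothesis UP : forall i, [/\ subgroup (U i), open (U i) & compact (U i)].
Hypothesis Ule : forall i j, (i <= j)%N -> U i `<=` U j.
Hypothesis Uex : forall x, exists i, U i x.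
Hypothesis pU : forall p, prime p -> primary_comp p [set: Q] `<=` U p.+1.
Hypothesis s0 : forall i, (0 < s i)%N.
Hypothesis hgen : forall i, generates (U i) (pi (h i)).
Hypothesis hS : forall i, h i = h i.+1 ^ s i.
Hypothesis hprof : forall i, profinite_type (h i).
Hypothesis sP : forall i (x : Q), generates (U i.+1) x ->
  forall n : int, U i (x ^ n) <-> ((s i)%:Z %| n)%Z.

Definition tower_union : set G := [set x | exists i, closure (cyc (h i)) x].

Local Notation H := tower_union.
Let Hn i := closure (cyc (h i)).

Let QC (x y : Q) : x * y = y * x.
Proof. by have [[_ + _] _] := piQ; apply. Qed.

Let U1 i : nbhs (1 : Q) (U i).
Proof. by have [sU oU _] := UP i; apply: open_nbhs_nbhs; split => //; exact: subgroup1. Qed.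

Let sU i : subgroup (U i). Proof. by have [] := UP i. Qed.

Let clU i : closed (U i).
Proof. by apply: compact_closed => //; have [] := UP i. Qed.

Let oK i : open (pi @^-1` U i).
Proof. by have [_ oU _] := UP i; apply: open_comp => // x _; exact: pi_cont. Qed.

Let sK i : subgroup (pi @^-1` U i).
Proof.
have [pi1 piV _] := morph_powz piM; split; first by rewrite /= pi1; exact: subgroup1.
split=> [x y Ux Uy|x Ux] /=; first by rewrite piM; exact: subgroupM.
by rewrite piV; exact: subgroupV.
Qed.

Let sH i : subgroup (Hn i). Proof. exact: subgroup_ccyc. Qed.
Let clH i : closed (Hn i). Proof. exact: closed_closure. Qed.

Let HnK i : Hn i `<=` pi @^-1` U i.
Proof.
apply: (ccyc_sub (@sK i)); last by have [] := hgen i.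
exact: ((continuous_closedP _).1 pi_cont _ (@clU i)).
Qed.

Let cH i : compact (Hn i).
Proof.
apply: (subclosed_compact (@clH i) _ (@HnK i)).
by apply: pi_proper; have [] := UP i.
Qed.

Let Hle i j : (i <= j)%N -> Hn i `<=` Hn j.
Proof.
move=> /subnKC <-; elim: (j - i)%N => [|d IH]; first by rewrite addn0.
rewrite addnS; apply: (subset_trans IH).
apply: (ccyc_sub (sH _) (@clH _)); rewrite hS; exact: ccyc_powz.
Qed.

(** Descent from level $j+1$ to [j]: an element of [Hn j.+1] lies in $h_{j+1}^k H_j$ with $k < s_j$.
    If its image lies in [U j], then $s_j$ divides [k], so $k = 0$. Thus $H_j$ is open in the
    union. *)
Let HnE i x : H x -> U i (pi x) -> Hn i x.
Proof.
have [pi1 piV piX] := morph_powz piM.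
have step j y : Hn j.+1 y -> U j (pi y) -> Hn j y.
  move=> Hy Uy; have [k ks] := ccyc_split (s0 j) Hy.
  rewrite -hS => Hky.
  have Uk : U j (pi (h j.+1) ^ k).
    have := @HnK j _ Hky; rewrite /= piM piX powzN => /(subgroup_coset_sym (sU j)) h1.
    exact: (subgroup_mem_coset (sU j) Uy h1).
  have := (sP (hgen j.+1) k).1 Uk; rewrite dvdzE /= => /dvdnP[q qE].
  have k0 : k = 0%N by case: q qE => [//|q]; nia.
  by move: Hky; rewrite k0 tg_mul1g.
move=> [j Hj] Ui; have [ij|ji] := leqP i j; last exact: Hle (ltnW ji) _ Hj.
move: Hj; rewrite -(subnKC ij); elim: (j - i)%N => [|d IH]; first by rewrite addn0.
rewrite addnS => /step h1; apply: IH; apply: h1.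
by apply: (Ule _ Ui); exact: leq_addr.
Qed.

Let HnH i : Hn i `<=` H. Proof. by move=> x Hx; exists i. Qed.

Lemma tower_union_subgroup : subgroup H.
Proof.
split; first by exists 0%N; exact: (subgroup1 (sH 0)).
split=> [x y [i Hx] [j Hy]|x [i Hx]]; last by exists i; exact: (subgroupV (sH i)).
exists (maxn i j); apply: (subgroupM (sH _)).
  exact: Hle (leq_maxl i j) _ Hx.
exact: Hle (leq_maxr i j) _ Hy.
Qed.

Lemma tower_union_closed : closed H.
Proof.
move=> x xH; have [i Ui] := Uex (pi x); exists i; apply: clH => O Ox.
have := xH _ (filterI Ox (open_nbhs_nbhs (conj (@oK i) Ui))).
by move=> [y [Hy [Oy Uy]]]; exists y; split => //; exact: HnE.
Qed.

Let HC x y : H x -> H y -> x * y = y * x.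
Proof.
move=> [i Hx] [j Hy]; apply: (ccyc_comm hG (x := h (maxn i j))).
  exact: Hle (leq_maxl i j) _ Hx.
exact: Hle (leq_maxr i j) _ Hy.
Qed.

Let ccycH y : H y -> closure (cyc y) `<=` H.
Proof. move=> Hy; exact: (ccyc_sub tower_union_subgroup tower_union_closed Hy). Qed.

Let ccycC y : H y -> compact (closure (cyc y)).
Proof.
move=> [i Hy]; apply: (subclosed_compact _ (@cH i)); first exact: closed_closure.
exact: (ccyc_sub (sH i) (@clH i) Hy).
Qed.

(** Points are separated by cosets of the closed subgroup generated by a power $h_n^d$: it is open
    in [Hn n], which is open in the union. Arbitrary subsets are allowed because the closures of the
    groups [cyc y] are needed as well. *)
Lemma tower_union_totally_disconnected S : S `<=` H -> totally_disconnected S.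
Proof.
move=> SH x Sx; apply/seteqP; split=> [y|_ ->]; last exact: connected_component_refl.
move=> [C [Cx CS conC] Cy]; apply: contrapT => yx.
have [i Hx] := SH x Sx; have [j Hy] := SH y (CS y Cy).
pose n := maxn i j.
have Hxy : Hn n (x^-1 * y).
  apply: (subgroupM (sH n)); last exact: Hle (leq_maxr i j) _ Hy.
  by apply: (subgroupV (sH n)); exact: Hle (leq_maxl i j) _ Hx.
have V1 : nbhs (1 : G) (~` [set x^-1 * y]).
  apply: open_nbhs_nbhs; split; first by apply: closed_openC; exact: closed_set1.
  move=> /= e; apply: yx; apply: (@tg_mulgI _ x^-1).
  by rewrite -e tg_mulVg.
have [d d0 PV] := profinite_type_ccyc (@hprof n) V1.
have [O oO PE] := @ccyc_open _ (h n) _ d0.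
set P := closure (cyc (h n ^ d)) in PV PE.
have sP' : subgroup P by exact: subgroup_ccyc.
suff : P (x^-1 * y) by move=> /PV; apply.
suff e : C `&` [set z | P (x^-1 * z)] = C by move: Cy; rewrite -e => -[].
apply: conC; first by exists x; split => //; rewrite /= tg_mulVg; exact: subgroup1.
  exists [set z | (O `&` pi @^-1` U n) (x^-1 * z)].
    by apply: open_coset; apply: openI.
  apply/seteqP; split=> z [Cz] /=; first by rewrite PE => -[Oz /HnK].
  move=> [Oz Uz]; split => //=; rewrite PE; split => //.
  apply: HnE => //; apply: (subgroupM tower_union_subgroup); last exact: SH _ (CS z Cz).
  exact: (subgroupV tower_union_subgroup (SH x Sx)).
exists [set z | P (x^-1 * z)] => //.
by apply: closed_coset; exact: closed_closure.
Qed.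

Lemma tower_union_locally_compact : locally_compact_in H.
Proof.
move=> x [i Hx]; exists (Hn i); split; [exact: cH | exact: HnH |].
exists (pi @^-1` U i); split; [exact: oK | exact: HnK Hx |].
by move=> y [Uy Hy]; exact: HnE.
Qed.

Lemma primary_comp_tower_union p x : primary_comp p H x <-> H x /\ pro_p p (closure (cyc x)).
Proof.
rewrite /primary_comp /=; split=> -[Hx]; rewrite closure_in_cyc //;
  [exact: tower_union_subgroup | exact: tower_union_closed
  | exact: tower_union_subgroup | exact: tower_union_closed].
Qed.

(* A pro-p element [y] lies in [h ^ i P] for each [P] = closure of <h ^ d>; the order
   [r] of [h] modulo [P] has its prime-to-p part dividing [i], so that [h ^ i] and
   the [i]-th power of the p-component of [h] agree modulo [P]. *)
Lemma tower_union_primary p : prime p ->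
  exists x, [/\ H x, p_type p x & primary_comp p H = closure (cyc x)].
Proof.
move=> pp; have [pi1 piV piX] := morph_powz piM.
(* The p-component of [Q] lies in [U p.+1], so this single level contains the whole p-component of
   the union. *)
pose N := p.+1; set w := h N.
have [x wx xP] := p_component pp (@cH N) (@clH N) (sH N) (@ccyc_id _ w).
have HNx : Hn N x by exact: wx.
have px : p_type p x := p_component_type pp (@hprof N) xP.
exists x; split => //; first exact: HnH HNx.
apply/seteqP; split=> y; last first.
  move=> xy; have Hy : H y by apply: (@ccycH x) => //; exact: HnH HNx.
  apply/primary_comp_tower_union; split => //; apply: pro_p_ccyc => //.
  - exact: ccycC.
  - by apply: tower_union_totally_disconnected; exact: ccycH.
  - exact: p_type_ccyc xy.
move=> /primary_comp_tower_union[Hy py].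
have sy := @subgroup_ccyc _ y.
have powP P : subgroup P -> open_in H P -> exists k : nat, P (y ^ (p ^ k)%N).
  move=> sP' [O oO PE].
  have [||k [Pk _]] := pro_p_power hG py (subgroupI sP' sy).
  - by move=> z [].
  - exists O => //; rewrite PE; apply/seteqP; split=> z [].
      by move=> [].
    by move=> Oz yz; split => //; split => //; exact: ccycH yz.
  by exists k.
have HNE i : Hn i = pi @^-1` U i `&` H.
  apply/seteqP; split=> z; first by move=> Hz; split; [exact: HnK | exact: HnH Hz].
  by move=> [Uz Hz]; exact: HnE.
have HNy : Hn N y.
  apply: HnE => //.
  (* As [y] has p-power order modulo the bottom level, [p] is the only prime whose component decides
     whether its image lies in [U N]. *)
  have [k yk] := powP (Hn 0%N) (sH 0%N) (ex_intro2 _ _ _ (@oK 0%N) (HNE 0%N)).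
  have pk0 : (0 < p ^ k)%N by rewrite expn_gt0 prime_gt0.
  apply: (dense_component_sub hQ piQ (sU N) (U1 N) pk0).
    by rewrite -piX; apply: (Ule (leq0n N)); exact: HnK.
  move=> q z qp qk pz _; have qE : q = p.
    by apply/eqP; rewrite -dvdn_prime2 //; move: qk; rewrite Euclid_dvdX // => /andP[].
  by apply: pU; rewrite ?qE // in pz *.
move=> O /nbhs_translate1 O1.
have [d d0 PO] := profinite_type_ccyc (@hprof N) O1.
have [O' oO' PE] := @ccyc_open _ w _ d0.
set P := closure (cyc (w ^ d)) in PE.
have sP' : subgroup P by exact: subgroup_ccyc.
have oP : open_in H P.
  exists (O' `&` pi @^-1` U N); first exact: openI.
  by rewrite -setIA -HNE.
have [k yk] := powP P sP' oP.
have [i _ wy] := ccyc_split d0 HNy.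
rewrite powzN -/P in wy.
have wiC (n : int) z : Hn N z -> w ^ n * z = z * w ^ n.
  by move=> Hz; apply: (ccyc_comm hG (x := w)) => //; exact: ccyc_powz.
have wik : P (w ^ (i%:Z * (p ^ k)%N%:Z)).
  rewrite powzM; have h1 := commuting_coset_powz (p ^ k)%N sP' (wiC i y HNy) wy.
  exact: (subgroup_mem_coset sP' yk (subgroup_coset_sym sP' h1)).
have Pd : P (w ^ d) by exact: ccyc_id.
have [r r0 rP] := cyc_order sP' d0 Pd.
have rE : (r = p ^ logn p r * r`_(p^')%N)%N by rewrite -p_part partnC.
have com : coprime p r`_(p^')%N by rewrite prime_coprime // -p'natE // part_pnat.
have mi : (r`_(p^')%N %| i)%N.
  have /rP : P (w ^ (i%:Z * (p ^ k)%N%:Z)) by [].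
  rewrite -PoszM dvdzE /= => ri.
  have : (r`_(p^')%N %| i * p ^ k)%N by apply: dvdn_trans ri; exact: dvdn_part.
  by rewrite Gauss_dvdl // coprime_sym coprimeXl.
have wx' : P ((w ^ i)^-1 * x ^ i).
  apply: (xP [set z | P ((w ^ i)^-1 * z ^ i)] (logn p r) (r`_(p^')%N)) => //.
  - have cf : continuous (fun z => (w ^ i)^-1 * z ^ i).
      by move=> z; apply: cvg_tg_mul; [exact: cvg_cst | apply: cvg_powz; exact: cvg_id].
    by apply: ((continuous_closedP _).1 cf); exact: closed_closure.
  move=> a /dvdzP[q qE] _ /=; rewrite -powzM -powzN -powzD rP.
  have -> : (- i%:Z + a * i%:Z = (a - 1) * i%:Z)%R by ring.
  by rewrite qE dvdzE !abszM -mulnA dvdn_mull //= {1}rE dvdn_mul.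
exists (x ^ i); split; first by exists i.
have : P (y^-1 * x ^ i) by apply: (subgroup_coset_trans sP' _ wx'); exact: (subgroup_coset_sym sP').
by move=> /PO; rewrite /= tg_mulVKg.
Qed.

Lemma pi_procyclic_tower_union : pi_procyclic_in H.
Proof.
split; first by split; [exact: tower_union_subgroup | exact: HC | exact: tower_union_locally_compact].
split; first exact: tower_union_totally_disconnected.
  move=> y Hy; rewrite closure_in_cyc //; first exact: ccycC.
    exact: tower_union_subgroup.
  exact: tower_union_closed.
move=> p pp; have [x [Hx px ->]] := tower_union_primary pp.
by apply: p_type_ccyc_structure => //; exact: ccycC.
Qed.

Lemma tower_union_surj (q : Q) : exists2 x, H x & pi x = q.
Proof.
have [pi1 piV _] := morph_powz piM.
have [i Uq] := Uex q.
have simg : subgroup (pi @` Hn i).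
  split; first by exists 1 => //; exact: (subgroup1 (sH i)).
  split=> [_ _ [x Hx <-] [y Hy <-]|_ [x Hx <-]].
    by exists (x * y) => //; exact: (subgroupM (sH i)).
  by exists x^-1 => //; exact: (subgroupV (sH i)).
have cimg : closed (pi @` Hn i).
  apply: compact_closed => //; apply: continuous_compact; last exact: cH.
  exact: continuous_subspaceT.
have := ccyc_sub simg cimg (_ : (pi @` Hn i) (pi (h i))).
rewrite (generates_ccyc hQ piQ (@clU i) (sU i) (hgen i)) => /(_ _ q Uq)[|x Hx <-].
  by exists (h i) => //; exact: ccyc_id.
by exists x => //; exact: HnH Hx.
Qed.

End Supplement.

Theorem theorem4p5 (G : TopGroup) (A : set G) :
  locally_compact_group G ->
  normal_subgroup A -> compact A ->
  quotient_pi_procyclic A ->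
  exists H : set G,
    [/\ subgroup H, closed H, pi_procyclic_in H &
        forall g : G, exists a h, [/\ A a, H h & g = tg_mul a h]].
Proof.
move=> [hG _] _ cA [Q [pi [[piM pi_cont pi_open] [pi_surj pi_ker piQ]]]].
have hQ := quotient_hausdorff hG cA piM pi_open pi_surj pi_ker.
have pi_proper := quotient_preimage_compact cA piM pi_open pi_surj pi_ker.
have [_ piV _] := morph_powz piM.
have QC (x y : Q) : tg_mul x y = tg_mul y x by have [[_ + _] _] := piQ; apply.
have [U [UP Ule Uex pU]] := procyclic_chain QC hQ piQ.
have [h [s [s0 hgen hS hprof sP]]] := profinite_tower hG hQ piM pi_cont pi_surj pi_proper piQ UP Ule.
exists (tower_union h); split.
- exact: tower_union_subgroup hS.
- exact: (tower_union_closed hQ piM pi_cont UP Ule Uex s0 hgen hS sP).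
- exact: (pi_procyclic_tower_union hG hQ piM pi_cont pi_proper piQ UP Ule Uex pU s0 hgen hS hprof sP).
move=> g; have [x Hx xE] := tower_union_surj hQ piM pi_cont pi_proper piQ UP Uex hgen (pi g).
exists (tg_mul g (tg_inv x)), x; split => //; last by rewrite tg_mulgVK.
by apply/pi_ker; rewrite piM piV xE tg_mulgV.
Qed.
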